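(* Let $d_1,\ldots,d_r$ and $d$ be positive integers such that $\operatorname{lcm}(d_1,\ldots,d_r)$ divides $d$, and let $j_1,\ldots,j_r$ be integers such that $\gcd(j_i,d)=d_i$ for $i=1,\ldots,r$. Moreover, let $q$ be a prime power with $q\equiv1\pmod d$, let $\omega$ be a primitive root of $\mathbb{F}_q$, and let $Q_1,\ldots,Q_r\in\mathbb{F}_q[T]$ be non-constant, squarefree and pairwise coprime polynomials. For every $\epsilon>0$, the number of $\xi\in\mathbb{F}_q$ such that for each $i=1,\ldots,r$ one has \begin{itemize} \item $Q_i(\xi)\neq0$, \item $\operatorname{ord}(Q_i(\xi))=\frac{q-1}{d_i}$, and \item $\log_{\omega}Q_i(\xi)\equiv j_i\pmod d$ \end{itemize} is \[ c\,\frac{\phi(\frac{q-1}{d_1})\cdots\phi(\frac{q-1}{d_r})}{(q-1)^r}\,q+O\left((\deg Q_1+\cdots+\deg Q_r)\,q^{\frac12+\epsilon}\right), \] where the implied constant depends only on $d_1,\ldots,d_r$ (including their number $r$), $d$ and $\epsilon$, and where \[ c:=c(d_1,\ldots,d_r,d):=\frac{1}{d^r}\prod_{i=1}^r\sum_{z_i\mid d}\frac{\mu\left(\frac{z_i}{\gcd(z_i,d_i)}\right)^2\phi(z_i)}{\phi\left(\frac{z_i}{\gcd(z_i,d_i)}\right)^2}, \] and this constant satisfies $c\in\left[\frac{1}{d^r},1\right]$.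
   Context: $\phi$ is Euler's totient function and $\mu$ is the Möbius function. $\operatorname{ord}(\cdot)$ is the multiplicative order of an element of $\mathbb{F}_q^{\ast}$. A primitive root of $\mathbb{F}_q$ is a generator of $\mathbb{F}_q^{\ast}$; for such $\omega$ and $\xi\in\mathbb{F}_q^{\ast}$, the discrete logarithm $\log_{\omega}(\xi)$ is the unique $e\in\{0,1,\ldots,q-2\}$ with $\xi=\omega^e$. The sums over $z_i\mid d$ range over positive divisors. *)

(* Defs.v *)
From mathcomp Require Import all_boot all_order all_fingroup all_algebra.
From mathcomp Require Import all_solvable all_field.
From mathcomp Require Import reals exp.

Set Implicit Arguments.
Unset Strict Implicit.
Unset Printing Implicit Defensive.

Import Order.TTheory GRing.Theory Num.Theory.
Local Open Scope ring_scope.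

Definition mobius (n : nat) : int :=
  if (0 < n)%N && all (fun p => logn p n == 1%N) (primes n)
  then (-1) ^+ size (primes n) else 0.

(* The zero polynomial is not squarefree; compare [poly_square_freeP]. *)
Definition squarefree_poly (F : fieldType) (p : {poly F}) : Prop :=
  forall u : {poly F}, size u != 1%N -> ~~ (u ^+ 2 %| p).

Section DiscreteLog.
Variable F : finFieldType.

Definition primitive_root (omega : {unit F}) : bool :=
  generator [set: {unit F}] omega.

(* Takes the junk value #|F|.-1 if [x] is not a power of [omega]. *)
Definition dlog (omega x : {unit F}) : nat :=
  find (fun e => x == omega ^+ e)%g (iota 0 #|F|.-1).

(* Takes the junk value 1 at 0. *)
Definition funit (x : F) : {unit F} := insubd (1%g : {unit F}) x.

Lemma val_funit (x : F) : x != 0 -> val (funit x) = x.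
Proof. by move=> x0; rewrite insubdK // -topredE /= unitfE. Qed.

Lemma card_units_finField : #|[set: {unit F}]| = #|F|.-1.
Proof. exact: card_finField_unit. Qed.

Lemma dlogP (omega x : {unit F}) (e : nat) : primitive_root omega ->
  (e < #|F|.-1)%N && (x == omega ^+ e)%g = (dlog omega x == e).
Proof.
move=> gen; have om : #[omega]%g = #|F|.-1.
  by rewrite -card_units_finField; apply/esym; move/eqP: gen => ->.
set n := #|F|.-1 in om *.
have lt_dlog : (dlog omega x < n)%N.
  rewrite /dlog -/n -[X in (_ < X)%N](size_iota 0) -has_find.
  have : x \in <[omega]>%g by move/eqP: gen => <-; rewrite inE.
  case/cyclePmin=> k; rewrite om => k_lt ->; apply/hasP.
  by exists k; rewrite ?mem_iota.
have E : x = (omega ^+ dlog omega x)%g.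
  apply/eqP; have := @nth_find _ 0%N (fun e => x == omega ^+ e)%g (iota 0 n).
  by rewrite nth_iota //; apply; rewrite has_find size_iota.
apply/andP/eqP=> [[e_lt /eqP xe]|<-]; last by split=> //; apply/eqP.
have /eqP := etrans (esym E) xe.
by rewrite eq_expg_mod_order om !modn_small // => /eqP.
Qed.

End DiscreteLog.

Definition xi_count (F : finFieldType) (omega : {unit F}) (r : nat)
    (d_ : 'I_r -> nat) (d : nat) (j : 'I_r -> int)
    (Q : 'I_r -> {poly F}) : nat :=
  #|[set xi : F | [forall i : 'I_r,
      [&& (Q i).[xi] != 0,
          #[funit (Q i).[xi]]%g == (#|F|.-1 %/ d_ i)%N
        & ((dlog omega (funit (Q i).[xi]))%:Z == j i %[mod d])%Z]]]|.

Definition main_const (R : realType) (r : nat) (d_ : 'I_r -> nat) (d : nat) : R :=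
  1 / d%:R ^+ r *
  \prod_(i < r) \sum_(z <- divisors d)
    let w := (z %/ gcdn z (d_ i))%N in
    ((mobius w)%:~R ^+ 2 * (totient z)%:R) / (totient w)%:R ^+ 2.

(* Main.v *)
Require Import Defs.
From HB Require Import structures.
From mathcomp Require Import all_boot all_order all_fingroup all_algebra.
From mathcomp Require Import all_solvable all_field.
From mathcomp Require Import reals exp.
From mathcomp Require Import ring zify.

(* The proof reduces to Weil's bound for multiplicative character sums. Writing
   n = q - 1, the condition on ord and log of Q_i(xi) says that log Q_i(xi) lies in the
   class of j_i modulo d and is divisible by p d_i for no prime p dividing n / d_i but
   not d / d_i. Sieving by these primes expresses the indicator function of this
   condition as a signed sum of at most 2^omega(n) = O(n^eps) indicator functions of
   residue classes, whose moduli M_i divide n. Expanding each of them in multiplicative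
   characters and applying Weil's bound, the number of xi with log Q_i(xi) in given
   classes modulo M_i is q / (M_1 ... M_r) up to (deg Q_1 + ... + deg Q_r) sqrt q. The
   densities multiply out to the main term because the factor of c at i equals
   1 / phi(d / d_i).

   Weil's bound is obtained from the L-function of the character, a polynomial of degree
   at most deg Q_1 + ... + deg Q_r whose reciprocal roots have the character sums over the
   extensions of F_q as negated power sums. Hence it suffices to bound the sums over
   F_(q^(2k)) by a constant times q^k, with any constant. This follows from Stepanov's
   method, where F_(q^(2k)) having square order s^2 lets one work with s-th powers in
   place of derivatives. *)

Set Implicit Arguments.
Unset Strict Implicit.
Unset Printing Implicit Defensive.

Import Order.TTheory GRing.Theory Num.Theory.
Local Open Scope ring_scope.

(** * Linear independence behind Stepanov's method *)

(** The obstacle in Stepanov's method is to show that the auxiliary polynomial is nonzero. This is a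
    statement of Kummer type: an M-th root of h(X)/h(x) satisfies no equation of degree less than M
    over K(x, X). A resultant carries it over to X = x^s as long as degrees in x stay below s. The
    method only yields upper bounds for the classes, but these suffice, as a nontrivial character
    sums to zero over the classes. The constant in front of q^k is harmless because it disappears on
    taking k-th roots for large k: each reciprocal root z satisfies |z|^2 <= q exactly, and the
    factor in Weil's bound is just the number of reciprocal roots. This makes the error linear in
    the degrees and uniform in q. Extension fields of F are not constructed; they appear as lists of
    fixed points of Frobenius powers in one algebraic closure. Characters of polynomials are defined
    through the norms from F[T]/(Q_i) to F, so that they visibly depend on residues modulo the
    product of the Q_i alone, which is what makes the L-function a polynomial. *)

Lemma exists_companion (K : fieldType) (P : {poly K}) (n : nat) :
  P \is monic -> size P = n.+2 -> exists A : 'M[K]_n.+1, char_poly A = P.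
Proof.
move=> mP sP; have e : (size P).-1 = n.+1 by rewrite sP.
by case: _ / e; exists (companionmx P); apply: companionmxK.
Qed.

Lemma det_companion_pow (K : fieldType) (P : {poly K}) (M n : nat) (c : K) :
  size P = n.+2 -> P %| 'X^M - c%:P -> exists b : K, b ^+ M = c ^+ n.+1.
Proof.
move=> sP dvP.
have P0 : P != 0 by rewrite -size_poly_eq0 sP.
have lc0 : lead_coef P != 0 by rewrite lead_coef_eq0.
have [||A chA] := @exists_companion K ((lead_coef P)^-1 *: P) n.
- by rewrite monicE lead_coefZ mulVf.
- by rewrite size_scale ?invr_eq0.
exists (\det A).
have /dvdpP[u eu] : char_poly A %| 'X^M - c%:P by rewrite chA dvdpZl ?invr_eq0.
have : horner_mx A ('X^M - c%:P) = 0.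
  by rewrite eu rmorphM /= Cayley_Hamilton mulr0.
rewrite rmorphB rmorphXn /= horner_mx_X horner_mx_C => /eqP; rewrite subr_eq0 => /eqP eA.
(* The companion matrix [A] of [P] satisfies [A ^+ M = c%:M]; take determinants. *)
have -> : c ^+ n.+1 = \det (A ^+ M) by rewrite eA det_scalar.
elim: M {dvP eu eA} => [|M IH]; first by rewrite !expr0 det1.
by rewrite !exprS det_mulmx IH.
Qed.

(* [K[x, X]] is encoded as [{poly {poly K}}] with outer variable [x]; this is
   the substitution [X := x^s]. *)
Definition subst_pow (K : fieldType) (s : nat) (p : {poly {poly K}}) : {poly K} :=
  (map_poly (comp_poly 'X^s) p).['X].

HB.instance Definition _ (K : fieldType) (s : nat) :=
  GRing.RMorphism.copy (@subst_pow K s)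
    (horner_eval 'X \o map_poly (comp_poly 'X^s)).

(** The monomial X^k x^l becomes x^(k s + l). For l < s these exponents are distinct, so that no two
    monomials collide. *)
Lemma subst_pow_eq0 (K : fieldType) (s : nat) (p : {poly {poly K}}) :
  (size p <= s)%N -> subst_pow s p = 0 -> p = 0.
Proof.
case: s => [|s] sp.
  by rewrite leqn0 size_poly_eq0 in sp; rewrite (eqP sp).
move=> e; apply/polyP => l; rewrite coef0.
have [ls|sl] := ltnP l s.+1; last by rewrite nth_default // (leq_trans sp).
apply/polyP => k; rewrite coef0.
have := congr1 (fun g : {poly K} => g`_(k * s.+1 + l)) e.
rewrite coef0 /subst_pow (@horner_coef_wide _ s.+1); last first.
  exact: leq_trans (size_poly _ _) sp.
rewrite coef_sum (bigD1 (Ordinal ls)) //= coef_map /= coefMXn.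
rewrite ltnNge leq_addl /= addnK coef_comp_poly_Xn // dvdn_mull // mulnK //.
rewrite big1 ?addr0 // => i /eqP il.
rewrite coef_map /= coefMXn; case: ltnP => // ik.
rewrite coef_comp_poly_Xn //; case: ifP => // /dvdnP[w ew].
case: il; apply/val_inj => /=.
have := congr1 (modn^~ s.+1) (subnK ik).
by rewrite ew !modnMDl !modn_small.
Qed.

Lemma mup_exp (K : fieldType) (x : K) (p : {poly K}) (n : nat) :
  p != 0 -> mup x (p ^+ n) = (n * mup x p)%N.
Proof.
move=> p0; elim: n => [|n IH]; first by rewrite expr0 mupNroot ?root1.
by rewrite exprS mupM ?expf_neq0 // IH mulSn.
Qed.

Lemma mup_map (K L : fieldType) (f : {rmorphism K -> L}) (x : K) (p : {poly K}) :
  p != 0 -> mup (f x) (map_poly f p) = mup x p.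
Proof.
move=> p0; have fp0 : map_poly f p != 0 by rewrite map_poly_eq0.
have E n : (n <= mup (f x) (map_poly f p))%N = (n <= mup x p)%N.
  by rewrite !mup_geq // -map_polyXsubC -rmorphXn /= dvdp_map.
by apply/eqP; rewrite eqn_leq -E leqnn E leqnn.
Qed.

Lemma fraction_num_den (R : idomainType) (x : {fraction R}) :
  exists a b : R, b != 0 /\ x * FracField.tofrac b = FracField.tofrac a.
Proof.
elim/quotW: x => y.
exists (frac y).1, (frac y).2; split; first exact: denom_ratioP.
unlock FracField.tofrac; rewrite -[_ * _]FracField.pi_mul.
apply/eqmodP; rewrite /= FracField.equivfE /= /FracField.mulf.
by rewrite !numden_Ratio ?mulf_neq0 ?oner_eq0 ?denom_ratioP // !mulr1 mulrC.
Qed.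

Lemma size_det_le (R : comNzRingType) (n b : nat) (A : 'M[{poly R}]_n) :
  (forall i j, size (A i j) <= b.+1)%N -> (size (\det A) <= (n * b).+1)%N.
Proof.
move=> hA; apply: (leq_trans (size_sum _ _ _)); apply/bigmax_leqP => s _.
rewrite mulr_sign; set p := \prod_i _.
have : (size p <= (n * b).+1)%N.
  apply: (leq_trans (size_prod_leq _ _)); rewrite card_ord leq_subLR addnS ltnS.
  apply: (@leq_trans (\sum_(i < n) b.+1)); first by apply: leq_sum.
  by rewrite sum_nat_const card_ord mulnS.
by case: ifP; rewrite ?size_polyN.
Qed.

Section Independence.
Variables (K : fieldType) (h : {poly K}) (M s t b : nat).
Hypotheses (M_gt0 : (0 < M)%N) (h0 : h != 0) (s_def : s = (t * M).+1).
Hypothesis h_frob : h ^+ s = h \Po 'X^s.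
(* No power [h ^+ k] with [0 < k < M] is an [M]-th power up to a constant. *)
Hypothesis h_prim :
  forall k, (0 < k < M)%N -> exists x, ~~ (M %| k * mup x h)%N.
Let R := {poly {poly K}}.
Let hx : R := map_poly polyC h.
Let hX : R := h%:P.

(** Compare the multiplicities of the outer variable at the point [x] of [h_prim], over the fraction
    field of the inner polynomials. There [hX] is a nonzero constant, so [M] would divide
    [k * mup x h]. *)
Lemma kummer_not_power (A B : R) (k : nat) : (0 < k < M)%N -> B != 0 ->
  A ^+ M * hx ^+ k = hX ^+ k * B ^+ M -> False.
Proof.
move=> kM B0 e; have [x] := h_prim kM.
pose f := @FracField.tofrac {poly K}; pose fC := f \o polyC.
have f0 (p : R) : (map_poly f p == 0) = (p == 0).
  rewrite -!size_poly_eq0 size_map_inj_poly ?rmorph0 //.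
  by move=> y z /eqP; rewrite tofrac_eq => /eqP.
have hx0 : hx != 0 by rewrite map_polyC_eq0.
have hX0 : hX != 0 by rewrite polyC_eq0.
have A0 : A != 0.
  apply: contraTneq isT => A0; have := congr1 (fun p : R => p == 0) e.
  rewrite A0 expr0n eqn0Ngt M_gt0 mul0r eqxx mulf_eq0 !expf_eq0.
  by rewrite (negPf hX0) (negPf B0) !andbF.
have := congr1 (fun p : R => mup (fC x) (map_poly f p)) e.
rewrite !rmorphM !rmorphXn /= !mupM ?expf_neq0 ?f0 // !mup_exp ?f0 //.
rewrite -map_poly_comp (mup_map fC) // map_polyC /= [mup _ _%:P]mupNroot; last first.
  by rewrite rootC tofrac_eq0.
rewrite muln0 add0n => ee /negP; apply.
by rewrite -(dvdn_addr _ (dvdn_mulr (mup (fC x) (map_poly f A)) (dvdnn M))) ee dvdn_mulr.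
Qed.

(** Otherwise there is a common factor of some degree k with 0 < k < M. By [det_companion_pow], the
    k-th power of h(X)/h(x) is then an M-th power in the fraction field, against
    [kummer_not_power]. *)
Lemma resultant_kummer_neq0 (P : {poly R}) : P != 0 -> (size P <= M)%N ->
  resultant P (hx *: 'X^M - hX%:P) != 0.
Proof.
move=> P0 sP; apply/negP; rewrite resultant_eq0; set G := gcdp _ _ => G1.
have hx0 : hx != 0 by rewrite map_polyC_eq0.
pose f : {rmorphism R -> {fraction R}} := @FracField.tofrac R.
have finj : injective f by move=> x y /eqP; rewrite tofrac_eq => /eqP.
have sfG : size (map_poly f G) = size G by rewrite size_map_inj_poly ?rmorph0.
have : (size G <= M)%N by apply: leq_trans (dvdp_leq P0 (dvdp_gcdl _ _)) sP.
case eG : (size G) sfG G1 => [|[|n]] // sfG _ nM.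
have /Pdiv.Idomain.dvdpP[[c u] /= c0 cu] := dvdp_gcdr P (hx *: 'X^M - hX%:P).
have [|B eB] := @det_companion_pow _ (map_poly f G) M n (f hX / f hx) sfG.
  have := congr1 (map_poly f) cu.
  rewrite linearZ /= rmorphM rmorphB /= linearZ /= map_polyXn map_polyC /=.
  move=> e; have dv : map_poly f G %| (f c * f hx) *: ('X^M - (f hX / f hx)%:P).
    rewrite -scalerA scalerBr -[f hx *: _%:P]mul_polyC -polyCM mulrCA.
    by rewrite divff ?tofrac_eq0 // mulr1 e dvdp_mull.
  by move: dv; rewrite dvdpZr // mulf_neq0 ?tofrac_eq0.
have [A [D [D0 eAD]]] := fraction_num_den B.
apply: (@kummer_not_power A D n.+1) => //.
apply: finj; rewrite !rmorphM !rmorphXn /= -eAD exprMn eB expr_div_n.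
by rewrite mulrAC divfK ?expf_neq0 ?tofrac_eq0.
Qed.

(* The resultant of [\sum_i U_i Y^i] and [h(x) Y^M - h(X)] is a polynomial in [x]
   and [X] which vanishes at [X = x^s], as both vanish at [Y = h^t]; its degree
   in [x] is less than [s], so it is zero. *)
Lemma kummer_independent (U : nat -> R) :
  (forall i, size (U i) <= b.+1)%N -> (size h <= b.+1)%N -> (2 * M * b < s)%N ->
  \sum_(i < M) subst_pow s (U i) * h ^+ (t * i) = 0 ->
  forall i, (i < M)%N -> U i = 0.
Proof.
move=> sU sh bs e0; pose P : {poly R} := \poly_(i < M) U i.
suff P0 : P = 0.
  move=> i iM; have := congr1 (fun p : {poly R} => p`_i) P0.
  by rewrite coef_poly iM coef0.
apply/eqP/negPn/negP => P0; have sP : (size P <= M)%N by apply: size_poly.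
have hx0 : hx != 0 by rewrite map_polyC_eq0.
pose ev (p : {poly R}) := (map_poly (subst_pow s) p).[h ^+ t].
have evP : ev P = 0.
  rewrite /ev (@horner_coef_wide _ M); last by rewrite (leq_trans (size_poly _ _)).
  rewrite -[RHS]e0; apply: eq_bigr => i _.
  by rewrite coef_map coef_poly ltn_ord exprM.
have bs' : (b < s)%N by nia.
(* Writing the resultant as a combination of both polynomials requires positive degrees in Y; a
   constant [P] is treated directly. *)
have [sP1|sP1] := leqP (size P) 1.
  have /negP := P0; apply.
  rewrite (size1_polyC sP1) polyC_eq0; apply/eqP/(@subst_pow_eq0 _ s).
      by rewrite coef_poly M_gt0 (leq_trans (sU _)).
  by rewrite -evP /ev {2}(size1_polyC sP1) map_polyC /= hornerC.
pose q : {poly R} := hx *: 'X^M - hX%:P.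
have sq : size q = M.+1.
  rewrite size_polyDl ?size_scale ?size_polyXn // size_polyN.
  by rewrite (leq_ltn_trans (size_polyC_leq1 _)).
have evq : ev q = 0.
  rewrite /ev rmorphB /= linearZ /= map_polyXn map_polyC /=.
  rewrite hornerD hornerN hornerC hornerZ hornerXn.
  rewrite -exprM; have -> : subst_pow s hx = h.
    rewrite /subst_pow -map_poly_comp (eq_map_poly (g := polyC)) => [|c /=]; last first.
      by rewrite comp_polyC.
    by rewrite -[RHS]comp_polyXr /comp_poly.
  have -> : subst_pow s hX = h ^+ s by rewrite /subst_pow map_polyC /= hornerC h_frob.
  by rewrite -exprS -s_def subrr.
have q1 : (1 < size q)%N by rewrite sq ltnS.
have [[u v] /= _ ruv] := resultant_in_ideal sP1 q1.
have /negP := resultant_kummer_neq0 P0 sP; apply; rewrite -/q; apply/eqP.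
apply: (@subst_pow_eq0 _ s); last first.
  have := congr1 ev ruv; rewrite /ev map_polyC /= hornerC => ->.
  by rewrite rmorphD !rmorphM /= hornerD !hornerM -/(ev P) -/(ev q) evP evq !mulr0 addr0.
(* The Sylvester matrix has at most [2 * M] rows, and its entries have degree at most [b] in x. *)
have hh : (((size q).-1 + (size P).-1) * b < s)%N.
  rewrite sq /=; apply: leq_ltn_trans bs; rewrite leq_mul2r mul2n -addnn leq_add2l.
  by rewrite (leq_trans (leq_pred _) sP) orbT.
apply: leq_trans hh; apply: size_det_le => i j; rewrite Sylvester_mxE.
have szMn (p : R) (c : bool) : (size p <= b.+1)%N -> (size (p *+ c) <= b.+1)%N.
  by case: c => //; rewrite ?mulr0n ?size_poly0 ?mulr1n.
case: split => k; apply: (szMn).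
  by rewrite coef_poly; case: ifP; rewrite ?size_poly0 ?sU.
rewrite coefB coefZ coefXn coefC; apply: leq_trans (size_polyD _ _) _.
rewrite size_polyN geq_max; apply/andP; split.
  by rewrite mulr_natr szMn // size_map_poly_id0 ?sh // polyC_eq0 lead_coef_eq0.
by case: ifP; rewrite ?size_poly0 // (leq_trans (size_polyC_leq1 _)).
Qed.

End Independence.

(** * Powers of the Frobenius map *)

Section Frobenius.
Variables (F : finFieldType) (k : nat).
Local Notation s := (#|F| ^ k)%N.

Lemma frobD (A : comNzRingType) (f : {rmorphism F -> A}) (x y : A) :
  (x + y) ^+ s = x ^+ s + y ^+ s.
Proof.
have [p p_pr pF] := finPcharP F.
apply: exprDn_pchar; rewrite pnatX; apply/orP; left.
have := pprimeChar_pgroup pF; rewrite /pgroup cardsT => pn.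
have := eq_pnat #|F| (pcharf_eq (rmorph_pchar f pF)) => ->.
exact: pn.
Qed.

Lemma frob_sum (A : comNzRingType) (f : {rmorphism F -> A}) (I : Type) (r : seq I)
    (P : pred I) (G : I -> A) :
  (\sum_(i <- r | P i) G i) ^+ s = \sum_(i <- r | P i) G i ^+ s.
Proof.
apply: (big_morph (fun x : A => x ^+ s)); first exact: frobD f.
by rewrite expr0n eqn0Ngt expn_gt0 (ltnW (finNzRing_gt1 F)).
Qed.

Lemma frob_fixed (a : F) : a ^+ s = a.
Proof. by elim: k => [|n IH]; rewrite ?expr1 // expnSr exprM IH expf_card. Qed.

Lemma frob_horner (K : comNzRingType) (f : {rmorphism F -> K}) (h : {poly F}) (x : K) :
  (map_poly f h).[x] ^+ s = (map_poly f h).[x ^+ s].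
Proof.
rewrite !horner_coef (frob_sum f); apply: eq_bigr => i _.
by rewrite exprMn coef_map /= -rmorphXn frob_fixed exprAC.
Qed.

Lemma frob_comp (K : fieldType) (f : {rmorphism F -> K}) (h : {poly F}) :
  map_poly f h ^+ s = map_poly f h \Po 'X^s.
Proof.
have := @frob_horner {poly K} (polyC \o f) h 'X.
by rewrite map_poly_comp /= -[in (_ ^+ s)]/(_ \Po 'X) comp_polyXr.
Qed.

End Frobenius.

Lemma poly_family_dependent (F : fieldType) (I : finType) (n : nat)
    (p : I -> {poly F}) :
  (forall i, size (p i) <= n)%N -> (n < #|I|)%N ->
  exists2 v : I -> F, exists i, v i != 0 & \sum_i v i *: p i = 0.
Proof.
move=> sp nI; pose A := \matrix_(i < #|I|) (poly_rV (p (enum_val i)) : 'rV_n).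
have /rowV0Pn[u /sub_kermxP uA u0] : kermx A != 0.
  rewrite kermx_eq0; apply/negP => /eqP rA.
  by have := rank_leq_col A; rewrite rA leqNgt nI.
exists (fun i => u 0 (enum_rank i)).
  have [i ui] : exists i, u 0 i != 0.
    apply/existsP; apply: contraNT u0; rewrite negb_exists => /forallP u0.
    by apply/eqP/rowP => i; rewrite mxE; apply/eqP; have := u0 i; rewrite negbK.
  by exists (enum_val i); rewrite enum_valK.
have := congr1 rVpoly uA; rewrite linear0 mulmx_sum_row linear_sum /= => uA0.
rewrite -[RHS]uA0.
rewrite (reindex (@enum_rank I)) /=; last by apply/onW_bij/enum_rank_bij.
apply: eq_bigr => i _; rewrite linearZ /= rowK enum_rankK; congr (_ *: _).
by rewrite poly_rV_K.
Qed.

(** * Stepanov's bound for one class *)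

Section Stepanov.
Variables (F : finFieldType) (K : fieldType) (iota : {rmorphism F -> K}).
Variables (h : {poly F}) (M : nat).
Local Notation q := #|F|.
Local Notation hK := (map_poly iota h).
Hypotheses (M_gt0 : (0 < M)%N) (M_dvd : (M %| q.-1)%N) (h0 : h != 0).
Hypothesis h_prim :
  forall k, (0 < k < M)%N -> exists x, ~~ (M %| k * mup x hK)%N.

Let dh := (size h).-1.

(* The coefficients [v] of the auxiliary polynomial
   [H = \sum_(i, j, l) v_ijl x^l h^(t i) x^(j s)] are chosen such that
   [E = \sum_(i, j, l) v_ijl x^(l s) c^i h^(t (M - 1 - i)) x^j] is zero.
   As [H(x)^s = H(x^s)], at a point of [rs] one has [H(x)^s h(x)^(t (M - 1)) = E(x)],
   so that all points of [rs] are roots of [H]; no derivatives are needed. *)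
Lemma stepanov (k : nat) (c : F) (rs : seq K) (s := (q ^ k)%N)
    (t := (s.-1 %/ M)%N) (B := (2 * dh + 3)%N) :
  (2 * M * dh + B < s)%N ->
  uniq rs ->
  (forall x, x \in rs -> [/\ x ^+ (s * s) = x, hK.[x] != 0 &
                             hK.[x] ^+ (t * s.+1) = iota c]) ->
  (M * size rs <= s * s + (1 + M * dh + M * B) * s)%N.
Proof.
move=> s_big urs rsP.
have s0 : (0 < s)%N by apply: leq_ltn_trans s_big.
have tM : s = (t * M).+1.
  rewrite divnK ?prednK //; apply: dvdn_trans M_dvd _.
  by rewrite /s -!subn1 -{2}(exp1n k) subn_exp dvdn_mulr.
have hK0 : hK != 0 by rewrite map_poly_eq0.
have sh : size h = dh.+1 by rewrite polySpred.
(* [b] is the largest value with [2 * M * b < s], as [kummer_independent] demands. There are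
   [M * J * al] unknowns and at most [N] equations. The part [M * t * al] of the unknowns is about
   [b * s]; the summand [B] of [J] makes up for the degree of [h], since [s <= 2 * M * al]. *)
pose b := (s.-1 %/ (2 * M))%N; pose J := (t + B)%N; pose al := b.+1.
have M2 : (0 < 2 * M)%N by rewrite muln_gt0.
have bM : (2 * M * b < s)%N by rewrite mulnC -[s in (_ < s)%N](prednK s0) ltnS leq_divM.
have dhb : (dh <= b)%N.
  rewrite leq_divRL //.
  move: s_big; rewrite -[s in (_ < s)%N](prednK s0) ltnS mulnC => s_big.
  exact: leq_trans (leq_addr _ _) s_big.
have alM : (s <= 2 * M * al)%N by rewrite -[s](prednK s0) mulnC ltn_ceil.
have leM (i : 'I_M) : (i <= M.-1)%N by rewrite -ltnS prednK.
pose I := ('I_M * 'I_J * 'I_al)%type.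
pose N := (b * s + dh * s + J)%N.
pose pE (x : I) : {poly F} :=
  (c ^+ x.1.1) *: (h ^+ (t * (M.-1 - x.1.1)) * 'X^(x.2 * s + x.1.2)).
have spE x : (size (pE x) <= N)%N.
  apply: leq_trans (size_scale_leq _ _) _; apply: leq_trans (size_polyMleq _ _) _.
  rewrite size_polyXn addnS /=; have := size_exp_leq h (t * (M.-1 - x.1.1)).
  rewrite sh /= => /(leq_add (leqnn (x.2 * s + x.1.2))); rewrite addnC => hh.
  apply: leq_trans hh _; have := ltn_ord x.2; have := ltn_ord x.1.2.
  rewrite /N /al ltnS; move: (x.1.1 : nat) (x.1.2 : nat) (x.2 : nat) => i j l jJ lb.
  rewrite addnS -addSn -addnS addnAC leq_add // leq_add //; first by rewrite leq_mul2r lb orbT.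
  rewrite leq_mul2l tM; apply/orP; right; apply: leqW.
  by rewrite leq_mul2l (leq_trans (leq_subr _ _) (leq_pred _)) orbT.
have NI : (N < #|{: I}|)%N.
  rewrite !card_prod !card_ord /N /J.
  have : (M * t + 1 = s)%N by rewrite tM mulnC addn1.
  move: alM s_big; rewrite -/al /al /B; move: (b) (t) (s) (dh) => b' t' s' d' h1 h2 h3.
  have h4 : (s' * d'.+1 <= 2 * M * b'.+1 * d'.+1)%N by rewrite leq_mul2r h1 orbT.
  have h5 : (b'.+1 <= M * b'.+1)%N by rewrite leq_pmull.
  have h6 : (M * (t' + (2 * d' + 3)) * b'.+1 =
      (M * t') * b'.+1 + 2 * M * b'.+1 * d'.+1 + M * b'.+1)%N by ring.
  have h7 : (t' <= M * t')%N by rewrite leq_pmull.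
  have h8 : ((M * t') * b'.+1 + b'.+1 = s' * b' + s')%N by rewrite -h3 mulnS; ring.
  have h9 : (s' * d'.+1 = d' * s' + s')%N by ring.
  rewrite h6 [(b' * s')%N]mulnC.
  move: h2 h3 h4 h5 h7 h8 h9; set u1 := (M * t' * _)%N; set u2 := (2 * M * _ * _)%N.
  set u3 := (M * b'.+1)%N; set u4 := (s' * b')%N; set u5 := (d' * s')%N.
  by clearbody u1 u2 u3 u4 u5; lia.
have [v [x0 vx0] vE] := poly_family_dependent spE NI.
(* [w] is [v] indexed by natural numbers, extended by 0, to fit the polynomial constructors
   below. *)
pose w i j l :=
  if [pick x : I | (x.1.1 == i :> nat) && (x.1.2 == j :> nat) && (x.2 == l :> nat)]
    is Some x then v x else 0.
have wE (x : I) : w x.1.1 x.1.2 x.2 = v x.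
  rewrite /w; case: pickP => [y /andP[/andP[/eqP e1 /eqP e2] /eqP e3]|/(_ x)].
    congr v; case: y x e1 e2 e3 => [[y1 y2] y3] [[x1 x2] x3] /=.
    by move=> /val_inj -> /val_inj -> /val_inj ->.
  by rewrite !eqxx.
pose U i : {poly {poly K}} := \poly_(l < al) \poly_(j < J) iota (w i j l).
pose H := \sum_(i < M) subst_pow s (U i) * hK ^+ (t * i).
have sU i : (size (U i) <= b.+1)%N by apply: size_poly.
have shK : (size hK <= b.+1)%N by rewrite size_map_poly sh ltnS.
have H0 : H != 0.
  apply/eqP => e0.
  have U0 := kummer_independent M_gt0 hK0 tM (frob_comp k iota h) h_prim sU shK bM e0.
  have := congr1 (fun p : {poly {poly K}} => p`_x0.2`_x0.1.2) (U0 x0.1.1 (ltn_ord _)).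
  rewrite /U !coef0 coef_poly ltn_ord coef_poly ltn_ord wE => /eqP; rewrite fmorph_eq0.
  by rewrite (negPf vx0).
have substU i : subst_pow s (U i) =
    \sum_(l < al) ((\poly_(j < J) iota (w i j l)) \Po 'X^s) * 'X^l.
  rewrite /subst_pow (@horner_coef_wide _ al).
    by apply: eq_bigr => l _; rewrite coef_map coef_poly ltn_ord.
  exact: leq_trans (size_poly _ _) (size_poly _ _).
have sH : (size H <= (b + dh * (t * M.-1) + J.-1 * s).+1)%N.
  apply: leq_trans (size_sum _ _ _) _; apply/bigmax_leqP => i _.
  apply: leq_trans (size_polyMleq _ _) _.
  have h1 : (size (hK ^+ (t * i)) <= (dh * (t * M.-1)).+1)%N.
    apply: leq_trans (size_exp_leq _ _) _; rewrite size_map_poly sh /= ltnS.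
    by rewrite !leq_mul2l leM !orbT.
  have h2 : (size (subst_pow s (U i)) <= (b + J.-1 * s).+1)%N.
    rewrite substU.
    apply: leq_trans (size_sum _ _ _) _; apply/bigmax_leqP => l _.
    apply: leq_trans (size_polyMleq _ _) _; rewrite size_polyXn addnS /=.
    apply: leq_trans (leq_add (size_comp_poly_leq _ _) (leqnn _)) _.
    rewrite size_polyXn /= addSn ltnS addnC leq_add //; first by rewrite -ltnS ltn_ord.
    rewrite leq_mul2r; apply/orP; right.
    by rewrite -!subn1 leq_sub2r // size_poly.
  rewrite -subn1 leq_subLR; apply: leq_trans (leq_add h2 h1) _.
  by rewrite addSn addnS add1n addnAC.
have Hroot : all (root H) rs.
  apply/allP => x xrs; have [xs hx hc] := rsP x xrs.
  have : H.[x] ^+ s * hK.[x] ^+ (t * M.-1) == 0; last first.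
    by rewrite mulf_eq0 !expf_eq0 (negPf hx) andbF orbF s0 => /andP[_].
  have := congr1 (fun p => (map_poly iota p).[x]) vE.
  rewrite rmorph0 horner0 => <-; apply/eqP.
  rewrite /H horner_sum (frob_sum k iota) mulr_suml.
  rewrite rmorph_sum horner_sum /=.
  transitivity (\sum_i \sum_j \sum_l
      (map_poly iota (v (i, j, l) *: pE (i, j, l))).[x]); last first.
    by rewrite !pair_bigA; apply: eq_bigr => -[[? ?] ?].
  apply: eq_bigr => i _.
  rewrite hornerM substU horner_sum exprMn (frob_sum k iota) -mulrA mulr_suml.
  rewrite exchange_big /=; apply: eq_bigr => l _.
  rewrite hornerM exprMn hornerXn.
  rewrite horner_comp hornerXn horner_poly (frob_sum k iota) !mulr_suml.
  apply: eq_bigr => j _.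
  rewrite !linearZ /= !hornerZ rmorphM /= !rmorphXn /=.
  rewrite hornerM map_polyX hornerXn !horner_exp (wE (i, j, l)).
  rewrite exprMn -/s; have -> : iota (v (i, j, l)) ^+ s = iota (v (i, j, l)).
    by rewrite -rmorphXn frob_fixed.
  have -> : x ^+ s ^+ j ^+ s = x ^+ j by rewrite exprAC -(exprM x s s) xs.
  have -> : x ^+ l ^+ s = x ^+ (l * s) by rewrite exprM.
  rewrite -exprM -exprD.
  (* The factor [h ^ (t * (M - 1))] is there for this identity: [h ^ (t * s.+1)] is the constant [c]
     on [rs], and the exponent left over is nonnegative. *)
  have -> : (t * i * s + t * M.-1 = (t * s.+1) * i + t * (M.-1 - i))%N.
    rewrite mulnBr mulnS mulnDl [(t * i * s)%N]mulnAC [(t * i + _)%N]addnC.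
    by rewrite -addnA subnKC // leq_mul2l leM orbT.
  rewrite !exprD (exprM _ (t * s.+1)%N) hc -!mulrA; congr (_ * _).
  by rewrite mulrA mulrC [x ^+ j * _]mulrC -mulrA.
have := leq_trans (max_poly_roots H0 Hroot urs) sH; rewrite ltnS => szrs.
apply: leq_trans (leq_mul (leqnn M) szrs) _.
(* After multiplication by [M], only [J.-1 * s] contributes to the order s^2, with leading
   coefficient 1 because [M * t < s]; all else is of order s. *)
have h1 : (t * M.-1 <= s)%N by rewrite tM leqW // leq_mul2l leq_pred orbT.
have h2 : (M * b <= s)%N by rewrite (leq_trans _ (ltnW bM)) // leq_mul2r leq_pmull ?orbT.
have h3 : (M * (dh * (t * M.-1)) <= M * dh * s)%N by rewrite -mulnA !leq_mul2l h1 !orbT.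
have h4 : (M * (J.-1 * s) <= s * s + M * B * s)%N.
  rewrite mulnA -mulnDl leq_mul2r; apply/orP; right.
  apply: (@leq_trans (M * J)); first by rewrite leq_mul2l leq_pred orbT.
  by rewrite /J mulnDr leq_add2r tM mulnC leqW.
rewrite 2!mulnDr 2!mulnDl mul1n.
by apply: leq_trans (leq_add (leq_add h2 h3) h4) _; rewrite addnCA.
Qed.

End Stepanov.

(** * Finite subfields of an algebraic closure *)

Section FixedPoints.
Variables (F : finFieldType) (K : closedFieldType) (iota : {rmorphism F -> K}).
Local Notation q := #|F|.

(** The embedding is an argument because it is what makes the power map additive, so that the
    morphism instances can be attached to [frob iota]. *)
Definition frob (f : {rmorphism F -> K}) (x : K) : K := x ^+ q.

Lemma frob_is_zmod_morphism : zmod_morphism (frob iota).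
Proof.
move=> x y; rewrite /frob; have := @frobD F 1 K iota (x - y) y.
by rewrite subrK expn1 => ->; rewrite addrK.
Qed.

Lemma frob_is_monoid_morphism : monoid_morphism (frob iota).
Proof. by split=> [|x y]; rewrite /frob ?expr1n ?exprMn. Qed.

HB.instance Definition _ := GRing.isZmodMorphism.Build K K (frob iota)
  frob_is_zmod_morphism.
HB.instance Definition _ := GRing.isMonoidMorphism.Build K K (frob iota)
  frob_is_monoid_morphism.

Lemma pow_fixed (n : nat) (a : F) : iota a ^+ (q ^ n) = iota a.
Proof. by rewrite -rmorphXn frob_fixed. Qed.

Lemma pow_inj (n : nat) : injective (fun x : K => x ^+ (q ^ n)).
Proof.
move=> x y /= e; apply/eqP; rewrite -subr_eq0.
have := @frobD F n K iota (x - y) y; rewrite subrK e -[LHS]add0r => /addIr/esym/eqP.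
by rewrite expf_eq0 => /andP[].
Qed.

(** The polynomial 'X^N - 'X is separable: the characteristic divides [N], so that its derivative is
    -1. *)
Lemma fixed_points_exist (m : nat) : (0 < m)%N ->
  {rs : seq K | uniq rs /\ size rs = (q ^ m)%N &
                forall x, (x \in rs) = (x ^+ (q ^ m) == x)}.
Proof.
move=> m0; set N := (q ^ m)%N; pose p : {poly K} := 'X^N - 'X.
have N1 : (1 < N)%N by rewrite -(exp1n m) ltn_exp2r // (finNzRing_gt1 F).
have sp : size p = N.+1 by rewrite size_polyDl ?size_polyXn // size_polyN size_polyX.
have N0 : N%:R = 0 :> K.
  have := @frobD F m K iota 1 (-1) => /=.
  have [pp p_pr pF] := finPcharP F.
  have [k ek] := p_natP (pprimeChar_pgroup pF).
  rewrite cardsT in ek; have eq : q = (pp ^ k)%N := ek.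
  have k0 : (0 < k)%N by case: (k) eq => // e; have := finNzRing_gt1 F; rewrite e.
  rewrite /N eq -(prednK k0) -(prednK m0) !expnS !natrM.
  by rewrite (pcharf0 (rmorph_pchar iota pF)) !mul0r.
have sep : separable_poly p.
  rewrite separable_poly.unlock /p derivB derivXn derivX -scaler_nat.
  rewrite N0 scale0r sub0r -[X in coprimep _ X]scaleN1r.
  by rewrite coprimepZr ?oppr_eq0 ?oner_eq0 ?coprimep1.
have [rs ers] := closed_field_poly_normal p.
have lp : lead_coef p = 1.
  by rewrite lead_coefDl ?lead_coefXn // size_polyN size_polyX size_polyXn.
rewrite lp scale1r in ers; exists rs.
  split; first by rewrite -separable_prod_XsubC -ers.
  by apply: succn_inj; rewrite -(size_prod_XsubC rs (@id K)) -ers sp.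
by move=> x; rewrite -root_prod_XsubC -ers rootE !hornerE subr_eq0.
Qed.

(** The extension of F of degree [m] inside [K]. The list is empty for [m = 0], where all of [K]
    would be fixed. *)
Definition fixed_points (m : nat) : seq K :=
  if (0 < m)%N =P true is ReflectT h then s2val (fixed_points_exist h) else [::].

Lemma fixed_points_uniq m : uniq (fixed_points m).
Proof. by rewrite /fixed_points; case: eqP => // h; case: fixed_points_exist => ? []. Qed.

Lemma size_fixed_points m : (0 < m)%N -> size (fixed_points m) = (q ^ m)%N.
Proof. by rewrite /fixed_points; case: eqP => // h; case: fixed_points_exist => ? []. Qed.

Lemma mem_fixed_points m x : (0 < m)%N -> (x \in fixed_points m) = (x ^+ (q ^ m) == x).
Proof. by rewrite /fixed_points; case: eqP => // h; case: fixed_points_exist => ? []. Qed.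

(* Takes the junk value 0 outside the image of [f]. *)
Definition descend (f : {rmorphism F -> K}) (y : K) : F :=
  odflt 0 [pick a | f a == y].

Lemma descendK (a : F) : descend iota (iota a) = a.
Proof.
rewrite /descend; case: pickP => [b /eqP /(fmorph_inj iota)|/(_ a)] //.
by rewrite eqxx.
Qed.

(** Otherwise [y] and the image of F would be q + 1 roots of 'X^q - 'X. *)
Lemma descendE (y : K) : y ^+ q = y -> iota (descend iota y) = y.
Proof.
move=> yq; rewrite /descend; case: pickP => [a /eqP|] //= noa.
have q1 := finNzRing_gt1 F; pose p : {poly K} := 'X^q - 'X.
have sp : size p = q.+1 by rewrite size_polyDl ?size_polyXn // size_polyN size_polyX.
have p0 : p != 0 by rewrite -size_poly_eq0 sp.
have rootE : all (root p) (y :: map iota (enum F)).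
  rewrite /= rootE !hornerE yq subrr eqxx /=.
  apply/allP => z /mapP[a _ ->]; rewrite rootE !hornerE.
  by rewrite -(expn1 q) pow_fixed subrr.
have urs : uniq (y :: map iota (enum F)).
  rewrite /= map_inj_uniq ?enum_uniq ?andbT; last exact: fmorph_inj.
  by apply/mapP => -[a _ ya]; have := noa a; rewrite -ya eqxx.
by have := max_poly_roots p0 rootE urs; rewrite /= sp size_map -cardE ltnn.
Qed.

(* For [x] of degree [d] over [F] and [d %| m], the power with exponent [m %/ d] of
   the minimal polynomial of [x]. *)
Definition conj_polyK (m : nat) (x : K) : {poly K} :=
  \prod_(i < m) ('X - (x ^+ (q ^ i))%:P).

Definition conj_poly (m : nat) (x : K) : {poly F} :=
  map_poly (descend iota) (conj_polyK m x).

Lemma descend_poly (p : {poly K}) : map_poly (frob iota) p = p ->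
  map_poly iota (map_poly (descend iota) p) = p.
Proof.
move=> e; have d0 : descend iota 0 = 0 by rewrite -(rmorph0 iota) descendK.
apply/polyP => i; rewrite coef_map /= coef_map_id0 // descendE //.
by rewrite -[RHS](congr1 (fun p : {poly K} => p`_i) e) coef_map.
Qed.

(** Frobenius permutes the linear factors cyclically, so it fixes the coefficients. *)
Lemma conj_polyE (m : nat) (x : K) : x ^+ (q ^ m) = x ->
  map_poly iota (conj_poly m x) = conj_polyK m x.
Proof.
move=> xm; apply: descend_poly; rewrite rmorph_prod /=.
under eq_bigr do rewrite map_polyXsubC /= /frob -exprM -expnSr.
case: m xm => [|m] xm; first by rewrite /conj_polyK !big_ord0.
by rewrite /conj_polyK big_ord_recr /= xm big_ord_recl /= mulrC.
Qed.

Lemma monic_conj_polyK m x : conj_polyK m x \is monic.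
Proof. by apply: monic_prod => i _; apply: monicXsubC. Qed.

Lemma size_conj_polyK m x : size (conj_polyK m x) = m.+1.
Proof.
rewrite /conj_polyK -(big_map _ xpredT (fun y => 'X - y%:P)) size_prod_XsubC.
by rewrite size_map /index_enum -enumT size_enum_ord.
Qed.

Lemma size_conj_poly m x : x ^+ (q ^ m) = x -> size (conj_poly m x) = m.+1.
Proof. by move=> e; rewrite -(size_map_poly iota) conj_polyE // size_conj_polyK. Qed.

Lemma monic_conj_poly m x : x ^+ (q ^ m) = x -> conj_poly m x \is monic.
Proof. by move=> e; rewrite -(map_monic iota) conj_polyE // monic_conj_polyK. Qed.

Lemma dvdp_conj_poly m x (g : {poly F}) : x ^+ (q ^ m) = x ->
  (conj_poly m x %| g) = (conj_polyK m x %| map_poly iota g).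
Proof. by move=> e; rewrite -(dvdp_map iota) conj_polyE. Qed.

Lemma prod_XsubC_exp_dvdp (zs : seq K) (k : nat) (p : {poly K}) :
  uniq zs -> (forall z, z \in zs -> ('X - z%:P) ^+ k %| p) ->
  (\prod_(z <- zs) ('X - z%:P)) ^+ k %| p.
Proof.
elim: zs => [|z zs IH] /=; first by rewrite big_nil expr1n dvd1p.
case/andP=> zn uz hz; rewrite big_cons exprMn Gauss_dvdp.
  rewrite hz ?mem_head //= IH // => y yz; apply: hz.
  by rewrite inE yz orbT.
by rewrite coprimep_expl // coprimep_expr // coprimep_sym coprimep_XsubC root_prod_XsubC.
Qed.

Lemma frob_roots (g : {poly F}) (rs : seq K) (x : K) :
  map_poly iota g = \prod_(y <- rs) ('X - y%:P) ->
  count_mem (x ^+ q) rs = count_mem x rs.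
Proof.
move=> e; have : perm_eq rs (map (frob iota) rs).
  apply/prod_XsubC_eq; rewrite big_map -e.
  have -> : \prod_(j <- rs) ('X - (frob iota j)%:P) = map_poly (frob iota) (map_poly iota g).
    by rewrite e rmorph_prod /=; apply: eq_bigr => y _; rewrite map_polyXsubC.
  rewrite -map_poly_comp; apply: eq_map_poly => a /=.
  by rewrite /frob -(expn1 q) pow_fixed.
move/seq.permP/(_ (pred1 (x ^+ q))) => ->; rewrite count_map; apply: eq_count => y /=.
by have := inj_eq (@pow_inj 1) y x; rewrite /= expn1.
Qed.

Lemma frob_roots_iter (g : {poly F}) (rs : seq K) (x : K) (i : nat) :
  map_poly iota g = \prod_(y <- rs) ('X - y%:P) ->
  count_mem (x ^+ (q ^ i)) rs = count_mem x rs.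
Proof.
move=> e; elim: i => [|i IH]; first by rewrite expr1.
by rewrite expnSr exprM (frob_roots _ e).
Qed.

Section Orbit.
Variables (x : K) (d : nat).
Hypotheses (d_gt0 : (0 < d)%N) (xd : x ^+ (q ^ d) = x).
Hypothesis d_min : forall m, (0 < m)%N -> x ^+ (q ^ m) = x -> (d <= m)%N.

Lemma pow_modd (m : nat) : x ^+ (q ^ m) = x ^+ (q ^ (m %% d)).
Proof.
rewrite {1}(divn_eq m d); elim: (m %/ d)%N => [|k IH]; first by rewrite mul0n.
by rewrite mulSn -addnA expnD exprM xd IH.
Qed.

Lemma pow_eq_dvdn (m : nat) : (x ^+ (q ^ m) == x) = (d %| m)%N.
Proof.
rewrite pow_modd /dvdn; have := ltn_pmod m d_gt0.
case: (m %% d)%N => [|r] rd; first by rewrite expr1 !eqxx.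
by apply/negbTE/eqP => /d_min => /(_ isT); rewrite leqNgt rd.
Qed.

Lemma conj_polyK_mul (k : nat) : conj_polyK (k * d) x = conj_polyK d x ^+ k.
Proof.
rewrite /conj_polyK -!(big_mkord xpredT (fun i => 'X - (x ^+ (q ^ i))%:P)).
elim: k => [|k IH]; first by rewrite mul0n big_nil expr0.
rewrite mulSn (@big_cat_nat _ _ _ d) //= ?leq_addr // exprS; congr (_ * _).
rewrite -[X in \prod_(X <= _ < _) _]add0n big_addn addKn -IH; apply: eq_bigr => i _.
by rewrite addnC expnD exprM xd.
Qed.

Lemma conj_uniq : uniq [seq x ^+ (q ^ i) | i <- seq.iota 0 d].
Proof.
rewrite map_inj_in_uniq ?iota_uniq // => i j; rewrite !mem_iota !add0n /=.
wlog ij : i j / (i <= j)%N.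
  move=> W id jd e; have /orP[ij|ji] := leq_total i j; first exact: W.
  by symmetry; apply: W => //.
move=> _ jd e; apply/eqP; rewrite eqn_leq ij /= leqNgt; apply/negP => lij.
have e' : x ^+ (q ^ (j - i)) = x.
  apply: (@pow_inj i); rewrite /= -exprM -expnD subnK //.
have := d_min _ e'; rewrite subn_gt0 lij => /(_ isT).
by rewrite leqNgt (leq_ltn_trans (leq_subr _ _) jd).
Qed.

(** The left factor is the k-th power of the product over the [d] distinct conjugates of [x], all of
    which have the same multiplicity in [g]. *)
Lemma conj_polyK_dvdp (k : nat) (g : {poly F}) (rs : seq K) :
  map_poly iota g = \prod_(y <- rs) ('X - y%:P) ->
  (conj_polyK (k * d) x %| map_poly iota g) = (k <= count_mem x rs)%N.
Proof.
move=> e; have g0 : map_poly iota g != 0.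
  by rewrite e monic_neq0 // monic_prod_XsubC.
rewrite conj_polyK_mul; apply/idP/idP => [dv|kx].
  rewrite -mu_prod_XsubC -e mup_geq //; apply: dvdp_trans dv; apply: dvdp_exp2r.
  rewrite /conj_polyK -(prednK d_gt0) big_ord_recl expr1; exact: dvdp_mulr.
have -> : conj_polyK d x = \prod_(z <- [seq x ^+ (q ^ i) | i <- seq.iota 0 d]) ('X - z%:P).
  by rewrite big_map -[d in seq.iota 0 d]subn0 big_mkord.
apply: prod_XsubC_exp_dvdp conj_uniq _ => z /mapP[i _ ->].
by rewrite -mup_geq // e mu_prod_XsubC (frob_roots_iter _ _ e).
Qed.

(** The [m] that contribute are the multiples [k * d] with [k] from 1 to the multiplicity of [x];
    they do not exceed [n], because each of the [d] conjugates has this multiplicity. *)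
Lemma sum_conj_dvdp (n : nat) (g : {poly F}) (rs : seq K) :
  map_poly iota g = \prod_(y <- rs) ('X - y%:P) -> (size rs <= n)%N ->
  (\sum_(1 <= m < n.+1)
     ((x ^+ (q ^ m) == x) && (conj_polyK m x %| map_poly iota g)%R))%N
  = count_mem x rs.
Proof.
move=> e rn; have g0 : map_poly iota g != 0.
  by rewrite e monic_neq0 // monic_prod_XsubC.
have sg : size (map_poly iota g) = (size rs).+1 by rewrite e (size_prod_XsubC rs id).
have dc : (d * count_mem x rs <= n)%N.
  have := conj_polyK_dvdp (count_mem x rs) e; rewrite leqnn => /(dvdp_leq g0).
  rewrite size_conj_polyK sg ltnS mulnC => h; exact: leq_trans h rn.
transitivity (\sum_(1 <= k < (count_mem x rs).+1) 1)%N; last first.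
  by rewrite sum_nat_const_nat subn1 muln1.
transitivity (count (fun m => (d %| m) && (m %/ d <= count_mem x rs))%N (seq.iota 1 n)).
  rewrite -sum1_count /index_iota subn1 [RHS]big_mkcond; apply: eq_bigr => m _.
  rewrite pow_eq_dvdn; case: (boolP (d %| m)%N) => //= /dvdnP[k ->].
  by rewrite (conj_polyK_dvdp _ e) mulnK //; case: ifP.
rewrite sum_nat_const_nat subn1 muln1 /=.
have -> : count_mem x rs = size (map (muln^~ d) (seq.iota 1 (count_mem x rs))).
  by rewrite size_map size_iota.
rewrite -size_filter; apply/perm_size/uniq_perm.
- by rewrite filter_uniq ?iota_uniq.
- rewrite map_inj_uniq ?iota_uniq // => k l /eqP.
  by rewrite eqn_mul2r eqn0Ngt d_gt0 => /eqP.
move=> m; rewrite mem_filter mem_iota size_map size_iota.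
apply/andP/mapP => [[/andP[/dvdnP[k ->]]]|[k]].
  rewrite mulnK // => kc; rewrite muln_gt0 => /andP[/andP[k0 _] _].
  by exists k => //; rewrite mem_iota k0 add1n ltnS.
rewrite mem_iota add1n ltnS => /andP[k0 kc] ->.
rewrite dvdn_mull // mulnK // kc muln_gt0 k0 d_gt0 add1n ltnS.
by rewrite (leq_trans _ dc) // mulnC leq_mul2l kc orbT.
Qed.

End Orbit.

(** All iterates of Frobenius at [x] are roots of [g], so two of them coincide. *)
Lemma orbit_degree (x : K) (g : {poly F}) : g != 0 -> root (map_poly iota g) x ->
  exists d, [/\ (0 < d)%N, x ^+ (q ^ d) = x &
    forall m, (0 < m)%N -> x ^+ (q ^ m) = x -> (d <= m)%N].
Proof.
move=> g0 gx; have g0' : map_poly iota g != 0 by rewrite map_poly_eq0.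
suff : exists d, (0 < d)%N && (x ^+ (q ^ d) == x).
  move=> exd; case: (ex_minnP exd) => d /andP[d0 /eqP xd] dm; exists d; split=> //.
  by move=> m m0 xm; apply: dm; rewrite m0 xm eqxx.
pose N := size (map_poly iota g).
pose u := [seq x ^+ (q ^ i) | i <- seq.iota 0 N].
have ru : all (root (map_poly iota g)) u.
  apply/allP => y /mapP[i _ ->]; rewrite rootE -(frob_horner i iota) (eqP gx).
  by rewrite expr0n expn_eq0 eqn0Ngt (ltnW (finNzRing_gt1 F)).
have : ~~ uniq u.
  apply/negP => uu; have := max_poly_roots g0' ru uu.
  by rewrite size_map size_iota ltnn.
move/(uniqPn 0) => [i [j [ij]]]; rewrite size_map size_iota => jN.
rewrite !(nth_map 0%N) ?size_iota ?(ltn_trans ij) // !nth_iota ?(ltn_trans ij) // !add0n.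
move=> e; exists (j - i)%N; rewrite subn_gt0 ij /=; apply/eqP/(@pow_inj i).
by rewrite /= -exprM -expnD subnK // ltnW.
Qed.

(* The analogue over [F[T]] of the identity [\sum_(m | n) Lambda(m) = log n]. *)
Lemma conj_poly_count (n : nat) (g : {poly F}) : g \is monic -> size g = n.+1 ->
  (\sum_(1 <= m < n.+1) \sum_(x <- fixed_points m) (conj_poly m x %| g)%R)%N = n.
Proof.
move=> mg sg; have g0 := monic_neq0 mg.
have [rs] := closed_field_poly_normal (map_poly iota g).
rewrite lead_coef_map (monicP mg) rmorph1 scale1r => e.
have srs : size rs = n.
  by apply: succn_inj; rewrite -sg -(size_map_poly iota) e (size_prod_XsubC rs id).
transitivity (\sum_(x <- undup rs) count_mem x rs)%N; last first.
  rewrite -srs -sum1_size -[RHS]big_undup_iterop_count /=; apply: eq_bigr => x _.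
  by rewrite Monoid.iteropE iter_addn_0 mul1n.
transitivity (\sum_(1 <= m < n.+1) \sum_(x <- undup rs)
    ((x ^+ (q ^ m) == x) && (conj_polyK m x %| map_poly iota g)%R))%N; last first.
  rewrite exchange_big /= big_seq [RHS]big_seq; apply: eq_bigr => x.
  rewrite mem_undup => xr.
  have [|d [d0 xd dm]] := @orbit_degree x g g0; first by rewrite e root_prod_XsubC.
  by apply: (sum_conj_dvdp d0 xd dm) => //; rewrite srs.
rewrite big_seq [RHS]big_seq; apply: eq_bigr => m; rewrite mem_index_iota => /andP[m0 _].
transitivity (\sum_(x <- [seq x <- fixed_points m | x \in rs]) (conj_poly m x %| g)%R)%N.
  rewrite big_filter [RHS]big_mkcond [LHS]big_seq [RHS]big_seq; apply: eq_bigr => x.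
  rewrite mem_fixed_points // => /eqP xm; case: ifPn => // xr.
  rewrite dvdp_conj_poly //; apply/eqP; rewrite eqb0; apply: contra xr => dv.
  rewrite -root_prod_XsubC -e -dvdp_XsubCl; apply: dvdp_trans dv.
  rewrite /conj_polyK -(prednK m0) big_ord_recl expr1; exact: dvdp_mulr.
transitivity (\sum_(x <- [seq x <- undup rs | x ^+ (q ^ m) == x]) (conj_poly m x %| g)%R)%N.
  apply/perm_big/uniq_perm.
  - by rewrite filter_uniq // fixed_points_uniq.
  - by rewrite filter_uniq // undup_uniq.
  by move=> x; rewrite !mem_filter mem_undup mem_fixed_points // andbC.
rewrite big_filter big_mkcond; apply: eq_bigr => x _.
by case: eqP => //= xm; rewrite dvdp_conj_poly.
Qed.

End FixedPoints.

(** * L-functions over [F[T]] *)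

Section LFunction.
Variables (F : finFieldType) (K : closedFieldType) (iota : {rmorphism F -> K}).
Variable X : {poly F} -> algC.
Hypotheses (X1 : X 1 = 1) (XM : forall f g, X (f * g) = X f * X g).

Definition monic_of_row (n : nat) (v : 'rV[F]_n) : {poly F} := 'X^n + rVpoly v.

Lemma size_monic_of_row n (v : 'rV[F]_n) : size (monic_of_row v) = n.+1.
Proof. by rewrite /monic_of_row size_polyDl size_polyXn // ltnS size_poly. Qed.

Lemma monic_of_row_monic n (v : 'rV[F]_n) : monic_of_row v \is monic.
Proof. by rewrite monicE lead_coefDl ?lead_coefXn // size_polyXn ltnS size_poly. Qed.

Lemma monic_of_row_inj n : injective (@monic_of_row n).
Proof. by move=> u v /addrI /(can_inj rVpolyK). Qed.

Lemma monic_of_rowK n (g : {poly F}) : g \is monic -> size g = n.+1 ->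
  monic_of_row (poly_rV (g - 'X^n) : 'rV_n) = g.
Proof.
move=> mg sg; rewrite /monic_of_row poly_rV_K; first by rewrite addrC subrK.
apply/leq_sizeP => i ni; rewrite coefB coefXn; have [->|] := eqVneq i n.
  by have := monicP mg; rewrite lead_coefE sg /= => ->; rewrite subrr.
by rewrite subr0 => i_n; rewrite nth_default // sg ltn_neqAle eq_sym i_n.
Qed.

(* The L-function of [X] is [\sum_n lcoef n T^n], and its logarithmic derivative is
   [\sum_m lsum f m T^(m - 1)]. *)
Definition lcoef (n : nat) : algC := \sum_(v : 'rV[F]_n) X (monic_of_row v).
Definition lsum (f : {rmorphism F -> K}) (m : nat) : algC :=
  \sum_(x <- fixed_points f m) X (conj_poly f m x).

Lemma lcoef0 : lcoef 0 = 1.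
Proof.
rewrite /lcoef (big_pred1 (0 : 'rV[F]_0)) => [|v]; last by rewrite thinmx0 /= eqxx.
by rewrite /monic_of_row linear0 addr0 expr0.
Qed.

(** Multiplication by [c] is a bijection from the monic polynomials of degree [n - m] onto the
    multiples of [c] among those of degree [n]. *)
Lemma sum_dvdp_monic (n m : nat) (c : {poly F}) : (m <= n)%N -> c \is monic ->
  size c = m.+1 ->
  \sum_(v : 'rV[F]_n | c %| monic_of_row v) X (monic_of_row v) = X c * lcoef (n - m).
Proof.
move=> mn mc sc; have c0 := monic_neq0 mc.
pose mul (w : 'rV[F]_(n - m)) : 'rV[F]_n := poly_rV (c * monic_of_row w - 'X^n).
have mulE w : monic_of_row (mul w) = c * monic_of_row w.
  apply: monic_of_rowK; first by rewrite rpredM ?monic_of_row_monic.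
  rewrite size_mul ?monic_neq0 ?monic_of_row_monic // sc size_monic_of_row.
  by rewrite addnS /= addSn subnKC.
pose quo (v : 'rV[F]_n) : 'rV[F]_(n - m) := poly_rV (monic_of_row v %/ c - 'X^(n - m)).
rewrite (reindex_onto mul quo) => [|v cv].
  rewrite /lcoef mulr_sumr; apply: eq_big => [w|w _]; last by rewrite mulE XM.
  rewrite mulE dvdp_mulr // /quo mulE mulKp //=; apply/eqP/monic_of_row_inj.
  by apply: monic_of_rowK; rewrite ?monic_of_row_monic ?size_monic_of_row.
apply: monic_of_row_inj; rewrite mulE /quo monic_of_rowK ?divpK 1?mulrC ?divpK //.
  have := monic_of_row_monic v; rewrite -{1}(divpK cv) => mm.
  by rewrite -(monicMr _ mc).
by rewrite size_divp // size_monic_of_row sc /= subSn.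
Qed.

(** The identity T L' = L (T L'/L) in coefficients. The weight [n] of each monic polynomial is
    expanded by [conj_poly_count]; exchanging the sums leaves sums over multiples of
    [conj_poly iota m x]. *)
Lemma lcoef_newton (n : nat) :
  lcoef n *+ n = \sum_(1 <= m < n.+1) lsum iota m * lcoef (n - m).
Proof.
rewrite /lcoef -sumrMnl.
transitivity (\sum_(v : 'rV[F]_n) \sum_(1 <= m < n.+1) \sum_(x <- fixed_points iota m)
   X (monic_of_row v) *+ (conj_poly iota m x %| monic_of_row v)%R).
  apply: eq_bigr => v _.
  have E := conj_poly_count iota (monic_of_row_monic v) (size_monic_of_row v).
  transitivity (X (monic_of_row v) *+
    \sum_(1 <= m < n.+1) \sum_(x <- fixed_points iota m)
      (conj_poly iota m x %| monic_of_row v)%R); first by rewrite E.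
  by rewrite -sumrMnr; apply: eq_bigr => m _; rewrite -sumrMnr.
rewrite exchange_big /= big_seq [RHS]big_seq; apply: eq_bigr => m.
rewrite mem_index_iota ltnS => /andP[m0 mn].
rewrite exchange_big /= /lsum mulr_suml big_seq [RHS]big_seq; apply: eq_bigr => x.
rewrite mem_fixed_points // => /eqP xm.
rewrite -(sum_dvdp_monic mn (monic_conj_poly iota xm) (size_conj_poly iota xm)) [RHS]big_mkcond.
by apply: eq_bigr => v _; case: ifP; rewrite ?mulr1n ?mulr0n.
Qed.

(* Multiplication by [u] permutes the monic polynomials of degree [n] modulo [Q],
   so that [X u * lcoef n = lcoef n]. *)
Lemma lcoef_eq0 (Q u : {poly F}) (n : nat) : Q != 0 -> (size Q <= n.+1)%N ->
  (forall f g, f %% Q = g %% Q -> X f = X g) -> coprimep u Q -> X u != 1 ->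
  lcoef n = 0.
Proof.
move=> Q0 sQ XQ cop Xu.
(* [tr] multiplies the residue modulo [Q] by [u] and keeps the quotient. As residues have degree
   less than [n], monic polynomials of degree [n] stay so. *)
pose tr (g : {poly F}) := g - g %% Q + (u * g) %% Q.
have trmod g : tr g %% Q = (u * g) %% Q.
  by rewrite /tr modpD modpD modpN modp_id subrr add0r modp_id.
have s_mod g : (size (g %% Q)%R <= n)%N.
  by rewrite -ltnS (leq_trans _ sQ) // ltn_modp.
have strv (v : 'rV[F]_n) :
    (size ((u * monic_of_row v) %% Q - monic_of_row v %% Q)%R < n.+1)%N.
  by rewrite ltnS (leq_trans (size_polyD _ _)) // size_polyN geq_max !s_mod.
have trE (v : 'rV[F]_n) : tr (monic_of_row v) = monic_of_row v +
   ((u * monic_of_row v) %% Q - monic_of_row v %% Q).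
  by rewrite /tr addrAC addrA.
pose phi (v : 'rV[F]_n) : 'rV[F]_n := poly_rV (tr (monic_of_row v) - 'X^n).
have phiE v : monic_of_row (phi v) = tr (monic_of_row v).
  apply: monic_of_rowK; rewrite trE.
    by rewrite monicE lead_coefDl ?(monicP (monic_of_row_monic v)) // size_monic_of_row.
  by rewrite size_polyDl size_monic_of_row.
have phi_inj : injective phi.
  move=> v w e; apply: monic_of_row_inj.
  have et : tr (monic_of_row v) = tr (monic_of_row w) by rewrite -!phiE e.
  have : Q %| u * (monic_of_row v - monic_of_row w).
    by rewrite mulrBr /dvdp modpD modpN -!trmod et subrr.
  rewrite Gauss_dvdpr 1?coprimep_sym // /dvdp modpD modpN subr_eq0 => /eqP em.
  have eu : (u * monic_of_row v) %% Q = (u * monic_of_row w) %% Q.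
    by rewrite -!trmod et.
  by move: et; rewrite /tr em eu => /addIr/addIr.
have : X u * lcoef n = lcoef n.
  rewrite /lcoef mulr_sumr [RHS](reindex_inj phi_inj) /=; apply: eq_bigr => v _.
  by rewrite -XM phiE; apply: XQ; rewrite trmod.
move/eqP; rewrite -subr_eq0 -{2}[lcoef n]mul1r -mulrBl mulf_eq0 subr_eq0.
by rewrite (negPf Xu) => /eqP.
Qed.

End LFunction.

(* Coefficients of [\prod_(z <- w) (1 - z T)]. *)
Fixpoint rev_coef (w : seq algC) (i : nat) : algC :=
  if w is z :: w' then
    rev_coef w' i - z * (if i is j.+1 then rev_coef w' j else 0)
  else (i == 0)%:R.

Lemma rev_coef_out (w : seq algC) (i : nat) : (size w < i)%N -> rev_coef w i = 0.
Proof.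
elim: w i => [|z w IH] [|i] //=; rewrite ltnS => wi.
by rewrite !IH ?mulr0 ?subr0 // ltnW.
Qed.

Lemma coef_prod_XsubC (w : seq algC) (k : nat) : (k <= size w)%N ->
  (\prod_(z <- w) ('X - z%:P))`_k = rev_coef w (size w - k).
Proof.
elim: w k => [|z w IH] k /= kw.
  by move: kw; rewrite leqn0 => /eqP ->; rewrite big_nil coef1.
rewrite big_cons mulrBl coefB coefXM coefCM.
case: k kw => [|k] kw /=.
  by rewrite IH // subn0 (rev_coef_out (ltnSn _)).
rewrite subSS IH // ; have [kw'|wk] := ltnP k (size w).
  by rewrite -(subnSK kw') IH // subnSK.
have -> : (size w - k = 0)%N by apply/eqP; rewrite subn_eq0.
by rewrite nth_default // size_prod_XsubC ltnS.
Qed.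

Lemma rev_coef0 (w : seq algC) : rev_coef w 0 = 1.
Proof. by elim: w => //= z w ->; rewrite mulr0 subr0. Qed.

(** Newton's identities, by induction on the number of factors. A new factor 1 - z T contributes the
    sum [tel], which telescopes. *)
Lemma rev_coef_newton (w : seq algC) (n : nat) :
  rev_coef w n *+ n =
  - \sum_(1 <= m < n.+1) (\sum_(z <- w) z ^+ m) * rev_coef w (n - m).
Proof.
elim: w n => [|z w IH] n.
  rewrite big1 => [|m _]; last by rewrite big_nil mul0r.
  by case: n => [|n]; rewrite ?mulr0n ?mul0rn oppr0.
pose c := rev_coef w; pose p m := \sum_(y <- w) y ^+ m.
case: n => [|n]; first by rewrite mulr0n big_geq // oppr0.
have bE i : rev_coef (z :: w) i.+1 = c i.+1 - z * c i by [].
have b0 : rev_coef (z :: w) 0 = 1 by rewrite rev_coef0.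
have c0 : c 0%N = 1 by apply: rev_coef0.
have tel : \sum_(1 <= m < n.+2) z ^+ m * rev_coef (z :: w) (n.+1 - m) = z * c n.
  elim: n => [|n IHn]; first by rewrite big_nat1 subnn b0 c0 expr1.
  rewrite big_nat_recl // subSS subn0 bE expr1.
  under eq_bigr do rewrite exprS subSS -mulrA.
  by rewrite -mulr_sumr IHn -mulrDr subrK.
have IH' i : c i *+ i = - \sum_(1 <= m < i.+1) p m * c (i - m)%N by apply: IH.
rewrite bE mulrnBl IH' -mulrnAr mulrSr IH'.
have -> : \sum_(1 <= m < n.+2) (\sum_(y <- z :: w) y ^+ m) * rev_coef (z :: w) (n.+1 - m)
  = z * c n + \sum_(1 <= m < n.+2) p m * rev_coef (z :: w) (n.+1 - m).
  by rewrite -tel -big_split /=; apply: eq_bigr => m _; rewrite big_cons mulrDl.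
rewrite !(@big_nat_recr _ _ _ n.+1) // subnn b0 c0.
have -> : \sum_(1 <= m < n.+1) p m * rev_coef (z :: w) (n.+1 - m) =
    \sum_(1 <= m < n.+1) p m * c (n.+1 - m)%N - z * \sum_(1 <= m < n.+1) p m * c (n - m)%N.
  rewrite mulr_sumr -sumrB big_nat [RHS]big_nat; apply: eq_bigr => m /andP[_ mn].
  by rewrite subSn // bE; ring.
by rewrite /= mulr1; ring.
Qed.

(** The reversed polynomial is monic of degree [D] because [a 0 = 1], and it splits over [algC]. If
    the last coefficients vanish, zeros occur in [w], which keeps its length equal to [D]. *)
Lemma exists_rev_coef (a : nat -> algC) (D : nat) : a 0%N = 1 ->
  (forall n, (D < n)%N -> a n = 0) ->
  exists w, size w = D /\ forall n, a n = rev_coef w n.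
Proof.
move=> a0 aD; pose p := \poly_(i < D.+1) a (D - i)%N.
have pD : p`_D = 1 by rewrite coef_poly ltnSn subnn.
have sp : size p = D.+1.
  apply/eqP; rewrite eqn_leq size_poly ltnNge; apply/negP.
  by move=> /leq_sizeP/(_ D (leqnn D))/eqP; rewrite pD oner_eq0.
have [w] := closed_field_poly_normal p.
rewrite lead_coefE sp pD scale1r => e.
have sw : size w = D by apply: succn_inj; rewrite -(size_prod_XsubC w id) -e sp.
exists w; split=> // n; have [nD|Dn] := leqP n D; last by rewrite aD // rev_coef_out ?sw.
by have := coef_prod_XsubC (leq_subr n (size w)); rewrite -e sw coef_poly ltnS leq_subr subKn.
Qed.

(** As [a 0 = 1], the recursion determines [S n] from its earlier values, and Newton's identities
    solve it. *)
Lemma power_sum_unique (a S : nat -> algC) (w : seq algC) :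
  (forall n, a n *+ n = \sum_(1 <= m < n.+1) S m * a (n - m)%N) ->
  (forall n, a n = rev_coef w n) ->
  forall n, (0 < n)%N -> S n = - \sum_(z <- w) z ^+ n.
Proof.
move=> aS aw n; have [k] := ubnP n; elim: k n => // k IH [|n] //; rewrite ltnS => nk _.
have := aS n.+1; rewrite aw rev_coef_newton !(@big_nat_recr _ _ _ n.+1) //=.
rewrite subnn aw rev_coef0 !mulr1.
rewrite opprD; set u := \sum_(1 <= m < n.+1) _; set v := \sum_(1 <= m < n.+1) _.
suff -> : v = - u by move=> /addrI ->.
rewrite -sumrN /v big_nat [RHS]big_nat; apply: eq_bigr => m /andP[m0 mn].
by rewrite IH ?aw ?mulNr // (leq_trans mn).
Qed.

Lemma bounded_powers_le (x B : algC) (k0 : nat) : 0 <= x ->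
  (forall k, (k0 <= k)%N -> x ^+ k <= B) -> x <= 1.
Proof.
move=> x0 xB; have [//|x1] := real_leP (ger0_real x0) (@real1 algC).
have y0 : 0 < x - 1 by rewrite subr_gt0.
have bern k : 1 + (x - 1) *+ k <= x ^+ k.
  elim: k => [|k IH]; first by rewrite mulr0n addr0 expr0.
  rewrite exprS; apply: le_trans (ler_wpM2l x0 IH).
  rewrite -[_ *+ k.+1]mulr_natr -[_ *+ k]mulr_natr -natr1 -subr_ge0.
  have -> : x * (1 + (x - 1) * k%:R) - (1 + (x - 1) * (k%:R + 1)) =
    (x - 1) * (x - 1) * k%:R by ring.
  by rewrite !mulr_ge0 ?ler0n // ltW.
have B0 : 0 <= B by apply: le_trans (xB k0 (leqnn _)); rewrite exprn_ge0.
pose k := maxn k0 (Num.bound (B / (x - 1))).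
have le1 := le_trans (bern k) (xB k (leq_maxl _ _)).
have := archi_boundP (divr_ge0 B0 (ltW y0)); rewrite ltr_pdivrMr // mulr_natl => lt1.
have le2 : (x - 1) *+ Num.bound (B / (x - 1)) <= 1 + (x - 1) *+ k.
  by rewrite ler_wpDl ?ler01 // ler_wpMn2l ?(ltW y0) // leq_maxr.
by have := lt_le_trans lt1 (le_trans le2 le1); rewrite ltxx.
Qed.

Lemma power_sum_bound (w : seq algC) (rho B : algC) (k0 : nat) : 0 < rho ->
  (forall k, (k0 <= k)%N -> `|\sum_(z <- w) z ^+ k| <= B * rho ^+ k) ->
  forall z, z \in w -> `|z| <= rho.
Proof.
move=> rho0 wB z zw; pose u := undup w.
(* [h] vanishes at all elements of [w] but [z], so that applying it to the shifts
   of the sequence of power sums isolates the powers of [z]. *)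
pose h : {poly algC} := \prod_(y <- rem z u) ('X - y%:P).
have zu : z \in u by rewrite mem_undup.
have hz : h.[z] != 0.
  by rewrite -rootE root_prod_XsubC mem_rem_uniq ?undup_uniq // inE eqxx.
have E k : \sum_(l < size h) h`_l * (\sum_(y <- w) y ^+ (k + l)) =
    z ^+ k * h.[z] *+ count_mem z w.
  under eq_bigr do rewrite mulr_sumr.
  rewrite exchange_big /=.
  under eq_bigr => y _.
    have -> : \sum_(l < size h) h`_l * y ^+ (k + l) = y ^+ k * h.[y].
      rewrite horner_coef mulr_sumr; apply: eq_bigr => l _.
      by rewrite exprD mulrCA.
    over.
  rewrite (bigID (pred1 z)) /= [X in _ + X]big1_seq ?addr0 => [|y /andP[yz yw]].
    rewrite (eq_bigr (fun _ => z ^+ k * h.[z])) => [|y /eqP -> //].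
    by rewrite big_const_seq iter_addr_0.

  have /eqP -> : root h y; last by rewrite mulr0.
  by rewrite root_prod_XsubC mem_rem_uniq ?undup_uniq // inE yz mem_undup.
pose B' := (\sum_(l < size h) `|h`_l| * (B * rho ^+ l)) / `|h.[z]|.
suff : `|z| / rho <= 1 by rewrite ler_pdivrMr // mul1r.
apply: (@bounded_powers_le _ B' k0) => [|k kk].
  by rewrite divr_ge0 // ltW.
rewrite expr_div_n ler_pdivrMr ?exprn_gt0 // /B' mulrAC ler_pdivlMr ?normr_gt0 //.
rewrite -normrX -normrM; apply: (@le_trans _ _ `|z ^+ k * h.[z] *+ count_mem z w|).
  rewrite normrMn -[leLHS]mulr1n ler_wpMn2l // -has_count has_pred1 //.
rewrite -E; apply: le_trans (ler_norm_sum _ _ _) _; rewrite mulr_suml.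
apply: ler_sum => l _; rewrite normrM -mulrA ler_wpM2l //.
apply: le_trans (wB _ _) _; first by rewrite (leq_trans kk) // leq_addr.
by rewrite exprD [rho ^+ k * _]mulrC mulrA.
Qed.

(** * Weil's bound *)

Lemma det_sub_scalar (R : comNzRingType) (n : nat) (A : 'M[R]_n) (z : R) :
  \det (A - z%:M) = (-1) ^+ n * (char_poly A).[z].
Proof.
rewrite /char_poly -[_.[z]]/(horner_eval z _) -det_map_mx -detZ; congr (\det _).
apply/matrixP => i j; rewrite !mxE /= /horner_eval hornerD hornerN hornerC hornerMn hornerX.
by rewrite mulN1r opprB.
Qed.

Section PolyNorm.
Variable F : fieldType.

(** The cast brings the dimension into the form [n.+1], where square matrices form the ring that
    [horner_mx] works in. *)
Definition square_companion (Q : {poly F}) : 'M[F]_((size Q).-2.+1) :=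
  if (size Q).-1 =P (size Q).-2.+1 is ReflectT e then castmx (e, e) (companionmx Q)
  else 0.

Lemma char_square_companion (Q : {poly F}) : Q \is monic -> (1 < size Q)%N ->
  char_poly (square_companion Q) = Q.
Proof.
move=> mQ sQ; rewrite /square_companion; case: eqP => [e|]; last first.
  by case; case: (size Q) sQ => [|[|]].
rewrite -[RHS](companionmxK mQ); by case: _ / e.
Qed.

(* The norm of [g] from [F[T]/(Q)] to [F], that is [Res(Q, g)] for monic [Q]. *)
Definition poly_norm (Q g : {poly F}) : F := \det (horner_mx (square_companion Q) g).

Lemma poly_norm1 Q : poly_norm Q 1 = 1.
Proof. by rewrite /poly_norm rmorph1 det1. Qed.

Lemma poly_normM Q f g : poly_norm Q (f * g) = poly_norm Q f * poly_norm Q g.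
Proof. by rewrite /poly_norm rmorphM det_mulmx. Qed.

Lemma poly_norm_mod Q f g : Q \is monic -> (1 < size Q)%N -> Q %| f - g ->
  poly_norm Q f = poly_norm Q g.
Proof.
move=> mQ sQ /dvdpP[u e]; rewrite /poly_norm; congr (\det _).
apply/eqP; rewrite -subr_eq0 -rmorphB e rmorphM /=.
have := Cayley_Hamilton (square_companion Q).
by rewrite char_square_companion // => ->; rewrite mulr0.
Qed.

(** Reciprocity of the resultant: a root [z] of [g] contributes the determinant of the companion
    matrix minus [z], which up to sign is its characteristic polynomial [Q] at [z]. *)
Lemma poly_norm_XsubC (K : fieldType) (f : {rmorphism F -> K}) Q (zs : seq K)
    (g : {poly F}) :
  Q \is monic -> (1 < size Q)%N ->
  map_poly f g = \prod_(z <- zs) ('X - z%:P) ->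
  f (poly_norm Q g) = (-1) ^+ ((size Q).-1 * size zs) * \prod_(z <- zs) (map_poly f Q).[z].
Proof.
move=> mQ sQ e; rewrite /poly_norm -det_map_mx map_horner_mx e.
set A := map_mx f _; have chA : char_poly A = map_poly f Q.
  by rewrite -[in RHS](char_square_companion mQ sQ) map_char_poly.
have sE : (size Q).-1 = (size Q).-2.+1 by case: (size Q) sQ => [|[|]].
elim: zs {e} => [|z zs IH]; first by rewrite !big_nil rmorph1 det1 muln0 mulr1.
rewrite !big_cons rmorphM /= det_mulmx IH mulnS exprD.
rewrite rmorphB /= horner_mx_X horner_mx_C.
rewrite det_sub_scalar chA -sE; ring.
Qed.

End PolyNorm.

Lemma expf_card_pred (F : finFieldType) (y : F) : y != 0 -> y ^+ #|F|.-1 = 1.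
Proof.
move=> y0; apply: (mulfI y0); rewrite -exprS mulr1 prednK ?expf_card //.
exact: ltnW (finNzRing_gt1 F).
Qed.

Lemma pred_sqr (n : nat) : (0 < n)%N -> (n * n).-1 = (n.-1 * n.+1)%N.
Proof. by case: n => // n _; rewrite mulSn /= [RHS]mulnS. Qed.

(** * Characters modulo the product of the Q_i and their L-functions *)

Section CharacterSum.
Variables (F : finFieldType) (K : closedFieldType) (iota : {rmorphism F -> K}).
Variables (I : finType) (Q : I -> {poly F}) (b : I -> nat) (M : nat) (psi : F -> algC).
Local Notation q := #|F|.
Local Notation h := (\prod_i Q i ^+ b i).
Local Notation hK := (map_poly iota h).
Local Notation m1 := ((#|F|).-1 %/ M)%N.
Hypotheses (mQ : forall i, Q i \is monic) (sQ : forall i, (1 < size (Q i))%N).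
Hypotheses (b_gt0 : forall i, (0 < b i)%N) (M_gt0 : (0 < M)%N) (M_dvd : (M %| q.-1)%N).
Hypothesis h_prim :
  forall k, (0 < k < M)%N -> exists x, ~~ (M %| k * mup x hK)%N.
Hypotheses (psi0 : psi 0 = 0) (psi1 : psi 1 = 1).
Hypothesis psiM : forall y z, psi (y * z) = psi y * psi z.
Hypothesis psi_norm : forall y, y != 0 -> `|psi y| = 1.
Hypothesis psi_class : forall y z, y != 0 -> z != 0 ->
  y ^+ m1 = z ^+ m1 -> psi y = psi z.
Hypothesis psi_nontrivial : exists2 y, y != 0 & psi y != 1.

Let dh := (size h).-1.

Lemma h_neq0 : h != 0.
Proof. by apply/prodf_neq0 => i _; rewrite expf_neq0 // monic_neq0. Qed.

Definition mult_norm (g : {poly F}) : F := \prod_i poly_norm (Q i) g ^+ b i.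
(** A Dirichlet character modulo [\prod_i Q i]. Its value at 'X - xi is [psi h.[xi]] times the
    constant [psi sgn], so that [lsum] at degree 1 is essentially the sum to be bounded. *)
Definition chi_poly (g : {poly F}) : algC := psi (mult_norm g).

Lemma mult_normM f g : mult_norm (f * g) = mult_norm f * mult_norm g.
Proof.
by rewrite /mult_norm -big_split /=; apply: eq_bigr => i _; rewrite poly_normM exprMn.
Qed.

Lemma chi_polyM f g : chi_poly (f * g) = chi_poly f * chi_poly g.
Proof. by rewrite /chi_poly mult_normM psiM. Qed.

Lemma chi_poly1 : chi_poly 1 = 1.
Proof.
rewrite /chi_poly /mult_norm big1 ?psi1 // => i _.
by rewrite poly_norm1 expr1n.
Qed.

Lemma chi_poly_mod f g : f %% (\prod_i Q i) = g %% (\prod_i Q i) ->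
  chi_poly f = chi_poly g.
Proof.
move=> e; congr psi; apply: eq_bigr => i _; congr (_ ^+ _).
apply: poly_norm_mod => //; apply: (@dvdp_trans _ (\prod_i Q i)).
  by rewrite (bigD1 i) //= dvdp_mulr.
by rewrite /dvdp modpD modpN e subrr.
Qed.

Let sgn : F := \prod_i ((-1) ^+ (size (Q i)).-1) ^+ b i.

Lemma sgn_sqr : sgn ^+ 2 = 1.
Proof.
rewrite /sgn -prodrXl big1 // => i _.
by rewrite -[in LHS]exprM sqrr_sign.
Qed.

(** By reciprocity, and because evaluation commutes with Frobenius. The exponent 1 + q + ... +
    q^(m-1) turns the power of h(x) into its norm from the extension of degree [m]. The sign
    disappears for even [m]. *)
Lemma mult_norm_conj (m : nat) (x : K) : x ^+ (q ^ m) = x ->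
  iota (mult_norm (conj_poly iota m x)) =
  iota sgn ^+ m * hK.[x] ^+ (\sum_(j < m) q ^ j)%N.
Proof.
move=> xm; pose zs := [seq x ^+ (q ^ j) | j <- seq.iota 0 m].
have e : map_poly iota (conj_poly iota m x) = \prod_(z <- zs) ('X - z%:P).
  by rewrite conj_polyE // /conj_polyK big_map -[m in seq.iota 0 m]subn0 big_mkord.
rewrite rmorph_prod /= [map_poly iota _]rmorph_prod /= horner_prod.
rewrite [iota sgn]rmorph_prod -!prodrXl -big_split /=.
apply: eq_bigr => i _; rewrite !rmorphXn /= horner_exp.
rewrite (poly_norm_XsubC (mQ i) (sQ i) e) size_map size_iota big_map.
rewrite -[m in seq.iota 0 m]subn0 big_mkord exprMn.
have -> : \prod_(j < m) (map_poly iota (Q i)).[x ^+ (q ^ j)] =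
   (map_poly iota (Q i)).[x] ^+ (\sum_(j < m) q ^ j)%N.
  by rewrite -prodrXr; apply: eq_bigr => j _; rewrite frob_horner.
by rewrite rmorphN1 -!exprM mulnAC [(b i * _)%N]mulnC.
Qed.

Section EvenDegree.
Variable k : nat.
Hypothesis k_gt0 : (0 < k)%N.
Local Notation s := (#|F| ^ k)%N.
Local Notation t := ((#|F| ^ k).-1 %/ M)%N.
Let E := fixed_points iota (2 * k).
Let N x := mult_norm (conj_poly iota (2 * k) x).

Lemma even_fixed x : (x \in E) = (x ^+ (s * s) == x).
Proof. by rewrite mem_fixed_points ?muln_gt0 // mul2n -addnn expnD. Qed.

Lemma M_dvd_s : (M %| s.-1)%N.
Proof. by apply: dvdn_trans M_dvd _; rewrite predn_exp dvdn_mulr. Qed.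

(** In the exponent, (q - 1)/M times (s^2 - 1)/(q - 1) is (s^2 - 1)/M = t (s + 1), which is the form
    that [stepanov] requires. *)
Lemma even_norm_class x : x \in E -> iota (N x ^+ m1) = hK.[x] ^+ (t * s.+1).
Proof.
rewrite mem_fixed_points ?muln_gt0 // => /eqP xE.
rewrite rmorphXn /= mult_norm_conj // exprM -rmorphXn sgn_sqr rmorph1 expr1n mul1r -exprM.
congr (_ ^+ _); apply/eqP; rewrite -(eqn_pmul2r M_gt0) -mulnA divnK //.
rewrite mulnAC divnK ?M_dvd_s // mulnC -predn_exp mul2n -addnn expnD.
by rewrite pred_sqr // expn_gt0 (ltnW (finNzRing_gt1 F)).
Qed.

Lemma even_norm_eq0 x : x \in E -> (N x == 0) = (hK.[x] == 0).
Proof.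
rewrite mem_fixed_points ?muln_gt0 // => /eqP xE.
rewrite -(fmorph_eq0 iota) mult_norm_conj // exprM -rmorphXn sgn_sqr rmorph1 expr1n mul1r.
have k2 : (0 < 2 * k)%N by rewrite muln_gt0.
by rewrite expf_eq0 -(prednK k2) big_ord_recl expn0.
Qed.

Lemma size_even_zeros : (size [seq x <- E | hK.[x] == 0%R] <= dh)%N.
Proof.
have hK0 : hK != 0 by rewrite map_poly_eq0 h_neq0.
rewrite -ltnS /dh -polySpred ?h_neq0 // -(size_map_poly iota); apply: max_poly_roots => //.
  by apply/allP => x; rewrite mem_filter => /andP[].
by rewrite filter_uniq // fixed_points_uniq.
Qed.

Let B := (1 + M * dh + M * (2 * dh + 3))%N.

(* Stepanov's bound for each class and the count of all points together give
   [\sum_c (s^2 + B s - M n_c) <= M (B s + dh)] for the class sizes [n_c], while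
   the values of [psi] on the classes sum to zero. *)
Lemma even_sum_bound : (2 * M * dh + (2 * dh + 3) < s)%N ->
  `|lsum chi_poly iota (2 * k)| <= ((B + dh) * s)%:R.
Proof.
move=> s_big.
(* On nonzero elements [psi] factors through y -> y^m1. [G] is the image of this map and [theta] the
   induced character. *)
pose G := [pred c : F | [exists y : F, (y != 0) && (y ^+ m1 == c)]].
pose rep c := odflt 0 [pick y : F | (y != 0) && (y ^+ m1 == c)].
pose theta c := psi (rep c).
have repP c : G c -> rep c != 0 /\ rep c ^+ m1 = c.
  rewrite /G /rep /= => /existsP[y yP]; case: pickP => [z /andP[z0 /eqP zc] //|/(_ y)].
  by rewrite yP.
have theta_psi y : y != 0 -> theta (y ^+ m1) = psi y.
  move=> y0; have [|r0 rc] := repP (y ^+ m1).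
    by apply/existsP; exists y; rewrite y0 eqxx.
  exact: psi_class.
pose cl c := [seq x <- E | (N x != 0) && (N x ^+ m1 == c)].
have clM c : (M * size (cl c) <= s * s + B * s)%N.
  apply: (@stepanov F K iota h M M_gt0 M_dvd h_neq0 h_prim k c) => //.
    by rewrite filter_uniq // fixed_points_uniq.
  move=> x; rewrite mem_filter => /andP[/andP[N0 /eqP Nc] xE].
  have := xE; rewrite even_fixed => /eqP xs; split=> //.
    by rewrite -even_norm_eq0.
  by rewrite -even_norm_class // Nc.
have sumE : lsum chi_poly iota (2 * k) = \sum_(c | G c) theta c *+ size (cl c).
  rewrite /lsum -/E (bigID (fun x => N x == 0)) /= big1 ?add0r => [|x /eqP Nx]; last first.
    by rewrite /chi_poly -/(N x) Nx psi0.
  rewrite (partition_big (fun x => N x ^+ m1) G) /= => [|x Nx]; last first.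
    by apply/existsP; exists (N x); rewrite Nx eqxx.
  apply: eq_bigr => c Gc; rewrite -sum1_size -sumrMnr /cl big_filter.
  by apply: eq_bigr => x /andP[Nx /eqP <-]; rewrite mulr1n theta_psi.
have theta0 : \sum_(c | G c) theta c = 0.
  have [y y0 psiy] := psi_nontrivial.
  have GM c : G (y ^+ m1 * c) = G c.
    apply/existsP/existsP => -[z /andP[z0 /eqP zc]].
      exists (y^-1 * z); rewrite mulf_neq0 ?invr_eq0 //= exprMn zc exprVn mulrA.
      by rewrite mulVf ?mul1r ?expf_neq0.
    by exists (y * z); rewrite mulf_neq0 //= exprMn zc.
  have : psi y * \sum_(c | G c) theta c = \sum_(c | G c) theta c.
    rewrite [RHS](reindex_inj (mulfI (expf_neq0 m1 y0))) /= mulr_sumr.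
    apply: eq_big => c; first by symmetry; exact: GM.
    move=> Gc; have [r0 rc] := repP c Gc.
    by rewrite -{2}rc -exprMn theta_psi ?mulf_neq0 // psiM.
  move/eqP; rewrite -subr_eq0 -{2}[\sum_(c | G c) _]mul1r -mulrBl mulf_eq0 subr_eq0.
  by rewrite (negPf psiy) => /eqP.
have cardG : (#|G| <= M)%N.
  have sp : size ('X^M - 1 : {poly F}) = M.+1 by rewrite size_XnsubC.
  have p0 : ('X^M - 1 : {poly F}) != 0 by rewrite -size_poly_eq0 sp.
  rewrite cardE -ltnS -sp; apply: max_poly_roots (enum_uniq _) => //.
  apply/allP => c; rewrite mem_enum => /existsP[y /andP[y0 /eqP <-]].
  by rewrite rootE !hornerE -exprM divnK // expf_card_pred // subrr.
have totE : (\sum_(c | G c) size (cl c) + dh >= s * s)%N.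
  have -> : (s * s = size E)%N by rewrite size_fixed_points ?muln_gt0 // mul2n -addnn expnD.
  rewrite -(count_predC (fun x => N x == 0) E) addnC leq_add //.
    rewrite -sum1_count (partition_big (fun x => N x ^+ m1) G) /=.
      by apply: leq_sum => c Gc; rewrite /cl -sum1_size big_filter.
    by move=> x Nx; apply/existsP; exists (N x); rewrite Nx eqxx.
  rewrite -size_filter; apply: leq_trans size_even_zeros.
  rewrite !size_filter (@eq_in_count _ _ (fun x => hK.[x] == 0)) // => x xE.
  exact: even_norm_eq0.
pose T := (s * s + B * s)%N.
have key : `|lsum chi_poly iota (2 * k)| * M%:R <= (M * (B * s + dh))%:R.
  rewrite -[M%:R]normr_nat -normrM sumE mulr_suml.
  (* The constant [T] may be inserted by [theta0]; the subtraction of natural numbers is exact by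
     [clM]. *)
  have -> : \sum_(c | G c) theta c *+ size (cl c) * M%:R =
     - \sum_(c | G c) theta c * (T - M * size (cl c))%:R.
    rewrite [in RHS](eq_bigr (fun c => theta c * T%:R - theta c *+ size (cl c) * M%:R)).
      by rewrite sumrB -[X in - (X - _)]mulr_suml theta0 mul0r sub0r opprK.
    move=> c Gc; rewrite natrB ?clM // natrM -[_ *+ size _]mulr_natr; ring.
  rewrite normrN; apply: le_trans (ler_norm_sum _ _ _) _.
  apply: (@le_trans _ _ (\sum_(c | G c) (T - M * size (cl c))%:R)).
    apply: ler_sum => c Gc; rewrite normrM normr_nat psi_norm ?mul1r //.
    by case: (repP c Gc).
  rewrite -natr_sum ler_nat sumnB; last by move=> c _; exact: clM.
  rewrite sum_nat_const -big_distrr /= leq_subLR.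
  apply: (@leq_trans (M * T)); first by rewrite leq_mul2r cardG orbT.
  rewrite -mulnDr leq_mul2l; apply/orP; right.
  by rewrite /T [(s * s + _)%N]addnC addnCA leq_add2l.
have M0 : 0 < M%:R :> algC by rewrite ltr0n.
rewrite -(ler_pM2r M0) -natrM; apply: le_trans key _; rewrite ler_nat mulnC leq_mul2r.
apply/orP; right; rewrite mulnDl leq_add2l leq_pmulr //.
by rewrite expn_gt0 (ltnW (finNzRing_gt1 F)).
Qed.

End EvenDegree.

(** [Bc] is the constant of [even_sum_bound]. As q^k > k, every [k >= k0] makes q^k exceed both the
    threshold of that lemma and [Bc + dh], which the next argument for nontriviality needs. *)
Let Bc := ((1 + M * dh + M * (2 * dh + 3)) + dh)%N.
Let k0 := (2 * M * dh + (2 * dh + 3) + (Bc + dh)).+1.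

Lemma large_pow k : (k0 <= k)%N -> (k0 < q ^ k)%N.
Proof. by move=> kk; apply: leq_ltn_trans kk (ltn_expl _ (finNzRing_gt1 F)). Qed.

Lemma lsum_even_le k : (k0 <= k)%N ->
  `|lsum chi_poly iota (2 * k)| <= (Bc * q ^ k)%:R.
Proof.
move=> kk; apply: even_sum_bound; first exact: leq_trans kk.
by apply: leq_trans (large_pow kk); rewrite ltnS leqW // leq_addr.
Qed.

Lemma coprimep_conj_poly m x (p : {poly F}) : x ^+ (q ^ m) = x ->
  (map_poly iota p).[x] != 0 -> coprimep (conj_poly iota m x) p.
Proof.
move=> xm px; rewrite -(coprimep_map iota) conj_polyE // /conj_polyK.
apply: (big_ind (fun g => coprimep g (map_poly iota p))).
- exact: coprime1p.
- by move=> f g cf cg; rewrite coprimepMl cf cg.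
move=> j _; rewrite coprimep_sym coprimep_XsubC rootE -frob_horner.
by rewrite expf_eq0 (negPf px) andbF.
Qed.

(** Nontriviality follows from the bound itself: if all values at points with h(x) != 0 were 1, the
    sum over the extension of degree [2 * k0] would be at least s^2 - dh, which exceeds Bc s. *)
Lemma exists_nontrivial_poly :
  exists2 u, coprimep u (\prod_i Q i) & chi_poly u != 1.
Proof.
pose E := fixed_points iota (2 * k0).
have [/hasP[x xE /andP[hx cx]]|noh] := boolP (has (fun x => (hK.[x] != 0) &&
   (chi_poly (conj_poly iota (2 * k0) x) != 1)) E).
  exists (conj_poly iota (2 * k0) x) => //; apply: coprimep_conj_poly.
    by move: xE; rewrite mem_fixed_points // => /eqP.
  apply: contra hx; rewrite rmorph_prod /= [map_poly iota _]rmorph_prod !horner_prod.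
  move=> /prodf_eq0[i _ /eqP qi]; apply/prodf_eq0; exists i => //.
  by rewrite rmorphXn /= horner_exp qi expf_eq0 b_gt0 eqxx.
have := lsum_even_le (leqnn k0); rewrite /lsum -/E (bigID (fun x => hK.[x] == 0)) /=.
rewrite big1_seq ?add0r => [|x /andP[/eqP hx xE]]; last first.
  have := even_norm_eq0 (isT : (0 < k0)%N) xE; rewrite hx eqxx => /eqP Nx.
  by rewrite /chi_poly Nx psi0.
rewrite -big_filter (eq_big_seq (fun _ => 1)) => [|x]; last first.
  rewrite mem_filter => /andP[hx xE]; apply/eqP; move/hasPn: noh => /(_ x xE).
  by rewrite hx /= negbK.
rewrite big_const_seq count_predT iter_addr_0 normr_nat ler_nat => le1.
have := size_even_zeros k0; rewrite -/E => le2.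
have := leq_add le1 le2; rewrite !size_filter addnC count_predC size_fixed_points //.
rewrite mul2n -addnn expnD leqNgt => /negP; case.
have := large_pow (leqnn k0); set s := (q ^ k0)%N => ks.
have Bs : (Bc + dh < s)%N.
  by apply: leq_trans ks; rewrite ltnS leqW // leq_addl.
apply: (@leq_trans ((Bc + dh.+1) * s)).
  by rewrite mulnDl -addnS leq_add2l leq_pmulr // (leq_ltn_trans _ Bs).
by rewrite leq_mul2r addnS Bs orbT.
Qed.

Lemma size_prod_Q : size (\prod_i Q i) = (\sum_i (size (Q i)).-1).+1.
Proof.
rewrite size_prod => [|i _]; last exact: monic_neq0.
have E : (\sum_i size (Q i) = \sum_i (size (Q i)).-1 + #|I|)%N.
  rewrite -sum1_card -big_split /=; apply: eq_bigr => i _.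
  by rewrite addn1 prednK // ltnW.
by rewrite E -addSn addnK.
Qed.

Lemma mult_norm_linear (xi : F) :
  mult_norm (conj_poly iota 1 (iota xi)) = sgn * h.[xi].
Proof.
apply: (fmorph_inj iota); rewrite mult_norm_conj; last by rewrite pow_fixed.
by rewrite expr1 big_ord1 expn0 expr1 rmorphM /= horner_map.
Qed.

Lemma norm_lsum1 : `|lsum chi_poly iota 1| = `|\sum_(xi : F) psi h.[xi]|.
Proof.
have -> : lsum chi_poly iota 1 = psi sgn * \sum_(xi : F) psi h.[xi].
  rewrite /lsum mulr_sumr.
  rewrite (perm_big (map iota (index_enum F))) /=; last first.
    apply: uniq_perm; first exact: fixed_points_uniq.
      rewrite map_inj_uniq ?index_enum_uniq //; exact: fmorph_inj.
    move=> x; rewrite mem_fixed_points // expn1; apply/eqP/mapP => [xq|[y _ ->]].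
      by exists (descend iota x); rewrite ?mem_index_enum ?descendE.
    by rewrite -{1}(expn1 q) pow_fixed.
  rewrite big_map; apply: eq_bigr => xi _.
  by rewrite /chi_poly mult_norm_linear psiM.
rewrite normrM psi_norm ?mul1r //.
by apply/prodf_neq0 => i _; rewrite !expf_neq0 // oppr_eq0 oner_eq0.
Qed.

Theorem weil_character_sum :
  `|\sum_(xi : F) psi h.[xi]| <= (\sum_i (size (Q i)).-1)%:R * sqrtC q%:R.
Proof.
set D := (\sum_i (size (Q i)).-1)%N.
have [u cu Xu] := exists_nontrivial_poly.
have aD n : (D < n)%N -> lcoef chi_poly n = 0.
  move=> Dn; apply: (lcoef_eq0 chi_polyM _ _ chi_poly_mod cu Xu).
    by apply/prodf_neq0 => i _; apply: monic_neq0.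
  by rewrite size_prod_Q ltnS ltnW.
have [w [sw aw]] := exists_rev_coef (lcoef0 chi_poly1) aD.
have Sw n : (0 < n)%N -> lsum chi_poly iota n = - \sum_(z <- w) z ^+ n.
  exact: (power_sum_unique (lcoef_newton iota chi_polyM) aw).
have q0 : 0 < q%:R :> algC by rewrite ltr0n (ltnW (finNzRing_gt1 F)).
(* Only the power sums of even degree are controlled, so the squares of the reciprocal roots are
   bounded by q. *)
have wq z : z \in w -> `|z| <= sqrtC q%:R.
  move=> zw; rewrite -(@ler_sqr algC) ?nnegrE ?sqrtC_ge0 ?normr_ge0 ?(ltW q0) //.
  rewrite sqrtCK -normrX.
  apply: (@power_sum_bound (map (fun z => z ^+ 2) w) q%:R Bc%:R k0) => // [k kk|].
    rewrite big_map; have := lsum_even_le kk; rewrite Sw ?muln_gt0 ?(leq_trans _ kk) // normrN.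
    rewrite (eq_bigr (fun y => (y ^+ 2) ^+ k)) => [|y _]; last by rewrite exprM.
    by rewrite natrM natrX.
  by apply/mapP; exists z.
rewrite -norm_lsum1 Sw // normrN; apply: le_trans (ler_norm_sum _ _ _) _.
under eq_bigr do rewrite expr1.
rewrite -sw mulr_natl -(iter_addr_0 (size w)).
rewrite -[in iter (size w)](count_predT w) -big_const_seq.
by rewrite big_seq [leRHS]big_seq; apply: ler_sum => z /wq.
Qed.

End CharacterSum.

(** * Characters given by the discrete logarithm *)

Section DlogCharacter.
Variables (F : finFieldType) (omega : {unit F}) (z : algC).
Local Notation n := (#|F|).-1.
Hypotheses (gen : primitive_root omega) (z_prim : n.-primitive_root z).

Definition dlog_char (x : F) : algC :=
  if x == 0 then 0 else z ^+ dlog omega (funit x).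

Lemma card_pred_gt0 : (0 < n)%N.
Proof. by have := finNzRing_gt1 F; case: #|F| => [|[|]]. Qed.

Lemma order_primitive_root : #[omega]%g = n.
Proof. by rewrite -card_units_finField; apply/esym; move/eqP: gen => ->. Qed.

Lemma dlogE (x : {unit F}) : x = (omega ^+ dlog omega x)%g.
Proof. by have := dlogP x (dlog omega x) gen; rewrite eqxx => /andP[_ /eqP]. Qed.

Lemma char_power (e : nat) : z ^+ dlog omega (omega ^+ e)%g = z ^+ e.
Proof.
apply/eqP; rewrite (eq_prim_root_expr z_prim) -order_primitive_root.
by rewrite -eq_expg_mod_order -dlogE.
Qed.

Lemma dlog_char0 : dlog_char 0 = 0.
Proof. by rewrite /dlog_char eqxx. Qed.

Lemma dlog_char1 : dlog_char 1 = 1.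
Proof.
rewrite /dlog_char oner_eq0.
have -> : funit 1 = (omega ^+ 0)%g :> {unit F}.
  by apply: val_inj; rewrite val_funit ?oner_eq0.
by rewrite char_power expr0.
Qed.

Lemma dlog_charM x y : dlog_char (x * y) = dlog_char x * dlog_char y.
Proof.
rewrite /dlog_char mulf_eq0; have [_|x0] := eqVneq x 0; first by rewrite mul0r.
have [_|y0] /= := eqVneq y 0; first by rewrite mulr0.
have -> : funit (x * y) = (omega ^+ (dlog omega (funit x) + dlog omega (funit y)))%g.
  apply: val_inj; rewrite expgD -!dlogE /= val_funit ?mulf_neq0 //.
  by rewrite -{1}(val_funit x0) -{1}(val_funit y0).
by rewrite char_power exprD.
Qed.

Lemma dlog_charX x (e : nat) : dlog_char (x ^+ e) = dlog_char x ^+ e.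
Proof.
by elim: e => [|e IH]; rewrite ?expr0 ?dlog_char1 // !exprS dlog_charM IH.
Qed.

Lemma dlog_char_prod (I : Type) (r : seq I) (G : I -> F) :
  dlog_char (\prod_(i <- r) G i) = \prod_(i <- r) dlog_char (G i).
Proof. exact: (big_morph dlog_char dlog_charM dlog_char1). Qed.

Lemma norm_dlog_char x : x != 0 -> `|dlog_char x| = 1.
Proof.
move=> x0; rewrite /dlog_char (negPf x0) normrX.
have -> : `|z| = 1; last by rewrite expr1n.
apply/eqP; rewrite -(@pexpr_eq1 _ _ n) ?card_pred_gt0 //.
by rewrite -normrX (prim_expr_order z_prim) normr1.
Qed.

Lemma dlog_char_omega : dlog_char (val omega) = z.
Proof.
rewrite /dlog_char; have w0 : val omega != 0 by have := valP omega; rewrite unitfE.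
rewrite (negPf w0); have -> : funit (val omega) = (omega ^+ 1)%g.
  by apply: val_inj; rewrite val_funit // expg1.
by rewrite char_power expr1.
Qed.

End DlogCharacter.

(** If [x] had degree [d] over F and multiplicity at least 2, the square of [conj_poly iota d x],
    which has coefficients in F, would divide [g]. *)
Lemma squarefree_simple_root (F : finFieldType) (K : closedFieldType)
    (iota : {rmorphism F -> K}) (g : {poly F}) (x : K) :
  g \is monic -> squarefree_poly g -> root (map_poly iota g) x ->
  mup x (map_poly iota g) = 1%N.
Proof.
move=> mg sf gx; have g0 := monic_neq0 mg.
have [rs] := closed_field_poly_normal (map_poly iota g).
rewrite lead_coef_map (monicP mg) rmorph1 scale1r => e.
have [d [d0 xd dm]] := orbit_degree g0 gx.
rewrite {1}e mu_prod_XsubC; apply/eqP; rewrite eqn_leq; apply/andP; split; last first.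
  by rewrite -has_count has_pred1 -root_prod_XsubC -e.
rewrite leqNgt -(conj_polyK_dvdp d0 xd dm 2 e) (conj_polyK_mul xd).
rewrite -(conj_polyE iota xd) -rmorphXn dvdp_map; apply: sf.
by rewrite (size_conj_poly iota xd) eqSS -lt0n.
Qed.

Lemma mup_prod (K : fieldType) (I : finType) (x : K) (G : I -> {poly K}) :
  (forall i, G i != 0) -> mup x (\prod_i G i) = (\sum_i mup x (G i))%N.
Proof.
move=> G0; suff : (\prod_i G i != 0) && (mup x (\prod_i G i) == \sum_i mup x (G i))%N.
  by case/andP=> _ /eqP.
apply: (big_ind2 (fun p k => (p != 0) && (mup x p == k))) => [|p k p' k'|i _].
- by rewrite oner_eq0 mupNroot ?root1.
- by move=> /andP[p0 /eqP <-] /andP[p0' /eqP <-]; rewrite mulf_neq0 // mupM // eqxx.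
by rewrite G0 eqxx.
Qed.

Lemma weil_dlog_monic (F : finFieldType) (omega : {unit F}) (z : algC)
    (I : finType) (Q : I -> {poly F}) (A : I -> nat) :
  primitive_root omega -> (#|F|.-1).-primitive_root z ->
  (forall i, Q i \is monic) -> (forall i, 1 < size (Q i))%N ->
  (forall i, squarefree_poly (Q i)) ->
  (forall i k, i != k -> coprimep (Q i) (Q k)) ->
  (forall i, 0 < A i)%N -> (exists i, A i < #|F|.-1)%N ->
  `|\sum_(xi : F) \prod_i dlog_char omega z (Q i).[xi] ^+ A i|
    <= (\sum_i (size (Q i)).-1)%:R * sqrtC #|F|%:R.
Proof.
move=> gen zp mQ sQ sfQ coQ A0 [i0 Ai0].
have [K [iota _]] := countable_algebraic_closure F.
(* [\prod_i Q_i ^+ A_i] is the [g]-th power of [\prod_i Q_i ^+ b_i], to which the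
   previous bound applies with the character [psi] of order [M]. *)
pose n := #|F|.-1; pose G := \big[gcdn/0%N]_i A i; pose g := gcdn n G.
have n0 : (0 < n)%N by apply: card_pred_gt0.
have g0 : (0 < g)%N by rewrite gcdn_gt0 n0.
have gA i : (g %| A i)%N by apply: dvdn_trans (dvdn_gcdr _ _) (biggcdn_inf i _ _).
have gn : (g %| n)%N by apply: dvdn_gcdl.
pose M := (n %/ g)%N; pose b i := (A i %/ g)%N.
have Mg : (M * g = n)%N by apply: divnK.
have bg i : (b i * g = A i)%N by apply: divnK.
have M0 : (0 < M)%N by rewrite divn_gt0 // dvdn_leq.
have Mn : (M %| n)%N by rewrite -Mg dvdn_mulr.
have b0 i : (0 < b i)%N by rewrite divn_gt0 // dvdn_leq.
have gE : (n %/ M = g)%N by rewrite -Mg mulKn.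
have g_lt : (g < n)%N by apply: leq_ltn_trans Ai0; apply: dvdn_leq.
pose chi := dlog_char omega z; pose psi y := chi y ^+ g.
have QK0 i : map_poly iota (Q i) != 0 by rewrite map_poly_eq0 monic_neq0.
(* As [M] and the [b i] have no common factor, [M] fails to divide some [k * b i]. A root of [Q i]
   is simple and no root of the other factors, so its multiplicity in the product is [b i]. *)
have prim k : (0 < k < M)%N ->
    exists x, ~~ (M %| k * mup x (map_poly iota (\prod_i Q i ^+ b i)))%N.
  move=> /andP[k0 kM].
  have [i Mi] : exists i, ~~ (M %| k * b i)%N.
    apply/existsP; apply: contraLR kM; rewrite negb_exists -leqNgt => /forallP kb.
    apply: dvdn_leq => //; rewrite -(dvdn_pmul2r g0) Mg /g muln_gcdr dvdn_gcd dvdn_mull //=.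
    apply: (big_ind (fun m => n %| k * m)%N) => [|u v ku kv|i _].
    - by rewrite muln0 dvdn0.
    - by rewrite muln_gcdr dvdn_gcd ku.
    by rewrite -Mg -(bg i) mulnA dvdn_pmul2r //; have := kb i; rewrite negbK.
  have /closed_rootP[x xr] : size (map_poly iota (Q i)) != 1%N.
    by rewrite size_map_poly; apply: contraTneq (sQ i) => ->.
  exists x; rewrite rmorph_prod /= mup_prod => [|j]; last first.
    by rewrite rmorphXn /= expf_neq0.
  rewrite (bigD1 i) //= rmorphXn /= mup_exp // squarefree_simple_root // muln1.
  rewrite big1 ?addn0 // => j ji; rewrite rmorphXn /= mup_exp // mupNroot ?muln0 //.
  apply: contraL xr => xj; have := coQ j i ji; rewrite -(coprimep_map iota).
  by move/coprimep_root => /(_ x xj); rewrite rootE.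
have := @weil_character_sum F K iota I Q b M psi mQ sQ b0 M0 Mn prim.
rewrite (eq_bigr (fun xi => \prod_i chi (Q i).[xi] ^+ A i)) => [|xi _]; last first.
  rewrite horner_prod /psi /chi dlog_char_prod // -prodrXl; apply: eq_bigr => i _.
  by rewrite horner_exp dlog_charX // -exprM bg.
apply.
- by rewrite /psi /chi dlog_char0 expr0n gtn_eqF.
- by rewrite /psi /chi dlog_char1 // expr1n.
- by move=> y y'; rewrite /psi /chi dlog_charM // exprMn.
- by move=> y y0; rewrite /psi normrX norm_dlog_char // expr1n.
- move=> y y' y0 y0'; rewrite -/n gE => e.
  by rewrite /psi -!dlog_charX // e.
exists (val omega); first by have := valP omega; rewrite unitfE.
rewrite /psi /chi dlog_char_omega // -(prim_order_dvd zp).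
by rewrite gtnNdvd.
Qed.

Lemma squarefree_scale (F : fieldType) (c : F) (p : {poly F}) : c != 0 ->
  squarefree_poly p -> squarefree_poly (c *: p).
Proof. by move=> c0 sf u /sf; rewrite dvdpZr. Qed.

(** The leading coefficients only contribute a factor of absolute value 1. *)
Lemma weil_dlog (F : finFieldType) (omega : {unit F}) (z : algC)
    (I : finType) (Q : I -> {poly F}) (A : I -> nat) :
  primitive_root omega -> (#|F|.-1).-primitive_root z ->
  (forall i, 1 < size (Q i))%N ->
  (forall i, squarefree_poly (Q i)) ->
  (forall i k, i != k -> coprimep (Q i) (Q k)) ->
  (forall i, 0 < A i)%N -> (exists i, A i < #|F|.-1)%N ->
  `|\sum_(xi : F) \prod_i dlog_char omega z (Q i).[xi] ^+ A i|
    <= (\sum_i (size (Q i)).-1)%:R * sqrtC #|F|%:R.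
Proof.
move=> gen zp sQ sfQ coQ A0 Ai0.
pose c i := lead_coef (Q i); pose P i := (c i)^-1 *: Q i.
have c0 i : c i != 0 by rewrite lead_coef_eq0 -size_poly_gt0 ltnW.
have ci0 i : (c i)^-1 != 0 by rewrite invr_eq0.
have QE i : Q i = c i *: P i by rewrite scalerA divff ?scale1r.
have sP i : size (P i) = size (Q i) by rewrite size_scale.
have mP i : P i \is monic by rewrite monicE lead_coefZ mulVf.
have sP1 i : (1 < size (P i))%N by rewrite sP.
have sfP i : squarefree_poly (P i) by apply: squarefree_scale.
have coP i k : i != k -> coprimep (P i) (P k).
  by move=> ik; rewrite coprimepZl // coprimepZr // coQ.
have := weil_dlog_monic gen zp mP sP1 sfP coP A0 Ai0.
rewrite (eq_bigr (fun i => (size (Q i)).-1)) => [|i _]; last by rewrite sP.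
apply: le_trans; set S := \sum_xi _; set T := \sum_xi _.
have -> : S = (\prod_i dlog_char omega z (c i) ^+ A i) * T.
  rewrite mulr_sumr; apply: eq_bigr => xi _; rewrite -big_split /=.
  by apply: eq_bigr => i _; rewrite {1}QE hornerZ dlog_charM // exprMn.
rewrite normrM normr_prod big1 ?mul1r // => i _.
by rewrite normrX norm_dlog_char // expr1n.
Qed.

(** * Values in given residue classes *)

Lemma sum_roots_unity (M : nat) (w : algC) : w ^+ M = 1 ->
  \sum_(a < M) w ^+ a.+1 = M%:R *+ (w == 1).
Proof.
move=> wM; have [->|w1] := eqVneq w 1.
  by under eq_bigr do rewrite expr1n; rewrite sumr_const card_ord.
rewrite mulr0n; under eq_bigr do rewrite exprS.
rewrite -mulr_sumr; have := subrX1 w M; rewrite wM subrr => /esym/eqP.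
by rewrite mulf_eq0 subr_eq0 (negPf w1) => /eqP ->; rewrite mulr0.
Qed.

Section ClassCount.
Variables (F : finFieldType) (omega : {unit F}).
Local Notation n := (#|F|).-1.
Variables (I : finType) (Q : I -> {poly F}) (M b : I -> nat).
Hypothesis gen : primitive_root omega.
Hypotheses (sQ : forall i, (1 < size (Q i))%N).
Hypotheses (sfQ : forall i, squarefree_poly (Q i)).
Hypothesis coQ : forall i k, i != k -> coprimep (Q i) (Q k).
Hypothesis Mn : forall i, (M i %| n)%N.

Definition in_class (i : I) (x : F) : bool :=
  (x != 0) && (dlog omega (funit x) == b i %[mod M i])%N.

Definition class_count : nat :=
  #|[pred xi : F | [forall i, in_class i (Q i).[xi]]]|.

Let D := (\sum_i (size (Q i)).-1)%N.

Lemma modulus_gt0 i : (0 < M i)%N.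
Proof. by apply: dvdn_gt0 (Mn i); apply: card_pred_gt0. Qed.

Lemma zeros_count : (#|F| <= #|[pred xi : F | [forall i, (Q i).[xi] != 0%R]]| + D)%N.
Proof.
rewrite -(cardC [pred xi : F | [forall i, (Q i).[xi] != 0]]) leq_add2l.
have P0 : \prod_i Q i != 0.
  by apply/prodf_neq0 => i _; rewrite -size_poly_gt0 ltnW.
rewrite cardE -ltnS; apply: (@leq_trans (size (\prod_i Q i))).
  apply: max_poly_roots (enum_uniq _) => //; apply/allP => x; rewrite mem_enum !inE.
  rewrite negb_forall => /existsP[i]; rewrite negbK => qi.
  by rewrite rootE horner_prod; apply/prodf_eq0; exists i.
rewrite size_prod => [|i _]; last by rewrite -size_poly_gt0 ltnW.
have E : (\sum_i size (Q i) = D + #|I|)%N.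
  rewrite -sum1_card -big_split /=; apply: eq_bigr => i _.
  by rewrite addn1 prednK // ltnW.
by rewrite E -addSn addnK.
Qed.

(** Orthogonality of characters turns the count into a sum over [\prod_i M i] tuples of characters.
    The trivial tuple counts the common non-zeros of the [Q i]; Weil's bound applies to all
    others. *)
Lemma class_count_algC :
  `|(class_count * \prod_i M i)%:R - #|F|%:R|
    <= (\prod_i M i)%:R * (D%:R * sqrtC #|F|%:R) :> algC.
Proof.
have n_gt0 := card_pred_gt0 F; have M_gt0 := modulus_gt0.
have [z zp] := C_prim_root_exists n_gt0.
pose chi := dlog_char omega z.
have zn : z ^+ n = 1 := prim_expr_order zp.
have z0 : z != 0.
  by apply: contra_eq_neq zn => ->; rewrite expr0n eqn0Ngt n_gt0 eq_sym oner_eq0.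
pose eta i := z ^+ (n %/ M i).
have eta0 i : eta i != 0 by rewrite expf_neq0.
have eta_norm i e : `|eta i ^+ e| = 1.
  have -> : eta i = chi (val omega) ^+ (n %/ M i) by rewrite /chi dlog_char_omega.
  rewrite -exprM normrX norm_dlog_char ?expr1n //.
  by have := valP omega; rewrite unitfE.
(* The exponents run through [a.+1], from 1 to [M i]: the trivial character is thus the n-th power
   of [chi] and still vanishes at 0, and all exponents are positive as [weil_dlog] requires. *)
pose T i (a : nat) (x : F) := chi x ^+ (a.+1 * (n %/ M i)) / eta i ^+ (a.+1 * b i).
have etaM i : eta i ^+ M i = 1 by rewrite -exprM divnK ?Mn.
have etaE i e : (eta i ^+ e == eta i ^+ b i) = (e == b i %[mod M i])%N.
  rewrite -!exprM (eq_prim_root_expr zp) -{2 4}(divnK (Mn i)) -!muln_modr.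
  by rewrite eqn_pmul2l // divn_gt0 ?M_gt0 // dvdn_leq.
have Mle i : (M i <= n)%N by apply: dvdn_leq.
have TE i x : ((in_class i x) * M i)%:R = \sum_(a : 'I_n | (a < M i)%N) T i a x.
  rewrite -(big_ord_widen _ (T i ^~ x) (Mle i)) /in_class.
  have [->|x0] /= := eqVneq x 0.
    rewrite mul0n big1 // => a _; rewrite /T /chi dlog_char0 expr0n muln_eq0 /=.
    by rewrite eqn0Ngt divn_gt0 ?M_gt0 // dvdn_leq // mul0r.
  pose w := eta i ^+ dlog omega (funit x) / eta i ^+ b i.
  have wM : w ^+ M i = 1.
    by rewrite /w expr_div_n ![eta i ^+ _ ^+ M i]exprAC etaM !expr1n divr1.
  rewrite (eq_bigr (fun a : 'I_(M i) => w ^+ a.+1)) => [|a _].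
    rewrite (sum_roots_unity wM) /w (can2_eq (divfK _) (mulfK _)) ?expf_neq0 // mul1r etaE.
    by case: eqP; rewrite ?mul1n ?mulr1n ?mul0n.
  rewrite /T /w /chi /dlog_char (negPf x0) expr_div_n -!exprM [(b i * _)%N]mulnC.
  congr (_ / _).
  by congr (_ ^+ _); ring.
pose fam := family (fun i (a : 'I_n) => (a < M i)%N).
pose TT (f : {ffun I -> 'I_n}) := \sum_(x : F) \prod_i T i (f i) (Q i).[x].
have countE : (class_count * \prod_i M i)%:R = \sum_(f in fam) TT f.
  rewrite /TT exchange_big /= /class_count -sum1_card big_distrl /= natr_sum.
  rewrite big_mkcond; apply: eq_bigr => x _.
  transitivity (\prod_i \sum_(a : 'I_n | (a < M i)%N) T i a (Q i).[x]); last first.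
    by rewrite bigA_distr_big_dep.
  under [RHS]eq_bigr do rewrite -TE natrM.
  rewrite big_split /= inE; case: forallP => /= [cl|ncl].
    by rewrite mul1n natr_prod [X in _ = X * _]big1 ?mul1r // => i _; rewrite cl.
  have [i ni] : exists i, ~~ in_class i (Q i).[x].
    by apply/existsP; rewrite -negb_forall; apply/forallP.
  by rewrite (bigD1 i) //= (negPf ni) mul0r mul0r.
have f0P i : ((M i).-1 < n)%N by rewrite (leq_trans _ (Mle i)) // prednK.
(* The tuple of trivial characters, [a.+1 = M i] for all [i]. *)
pose f0 : {ffun I -> 'I_n} := [ffun i => Ordinal (f0P i)].
have f0fam : f0 \in fam.
  by apply/familyP => i; rewrite ffunE /= unfold_in /= prednK.
have main f : f \in fam -> `|TT f - #|F|%:R *+ (f == f0)| <= D%:R * sqrtC #|F|%:R.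
  move=> /familyP ff; have q1 : 1 <= #|F|%:R :> algC by rewrite ler1n (ltnW (finNzRing_gt1 F)).
  have [->|ff0] := eqVneq f f0.
    rewrite mulr1n; have -> : TT f0 = #|[pred xi : F | [forall i, (Q i).[xi] != 0]]|%:R.
      rewrite /TT -[in RHS]sum1_card natr_sum [RHS]big_mkcond; apply: eq_bigr => x _.
      case: ifPn => [/forallP Qx|].
        rewrite big1 // => i _; rewrite /T ffunE /= prednK // mulnC divnK //.
        rewrite mulnC exprM (_ : eta i ^+ b i ^+ M i = 1) ?divr1; last first.
          by rewrite exprAC etaM expr1n.
        by rewrite /chi /dlog_char (negPf (Qx i)) exprAC zn expr1n.
      rewrite inE negb_forall => /existsP[i]; rewrite negbK => /eqP Qx.
      rewrite (bigD1 i) //= Qx /T /chi dlog_char0 expr0n muln_eq0 /=.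
      by rewrite eqn0Ngt divn_gt0 // Mle !mul0r.
    rewrite distrC ger0_norm ?subr_ge0 ?ler_nat ?max_card // lerBlDr.
    apply: (@le_trans _ _ (D + #|[pred xi : F | [forall i, (Q i).[xi] != 0]]|)%:R).
      by rewrite ler_nat addnC zeros_count.
    rewrite natrD lerD2r -[leLHS]mulr1 ler_wpM2l ?ler0n //.
    by rewrite -(@ler_sqr algC) ?nnegrE ?sqrtC_ge0 ?ler0n ?ler01 // sqrtCK expr1n.
  rewrite mulr0n subr0 /TT.
  have -> : \sum_x \prod_i T i (f i) (Q i).[x] = (\prod_i (eta i ^+ ((f i).+1 * b i))^-1) *
      \sum_x \prod_i chi (Q i).[x] ^+ ((f i).+1 * (n %/ M i)).
    rewrite mulr_sumr; apply: eq_bigr => x _; rewrite -big_split /=.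
    by apply: eq_bigr => i _; rewrite /T mulrC.
  rewrite normrM normr_prod big1 ?mul1r => [|i _]; last by rewrite normfV eta_norm invr1.
  apply: weil_dlog => //.
    by move=> i; rewrite muln_gt0 /= divn_gt0 // Mle.
  have [i fi] : exists i, f i != f0 i.
    apply/existsP; rewrite -negb_forall; apply: contra ff0 => /forallP e.
    by apply/eqP/ffunP => i; apply/eqP.
  exists i; rewrite -[X in (_ < X)%N](divnK (Mn i)) mulnC ltn_pmul2l ?divn_gt0 // ?Mle //.
  have := ff i; rewrite unfold_in /= => fM; rewrite -(prednK (M_gt0 i)) ltnS.
  rewrite ltn_neqAle -ltnS prednK // fM andbT; apply: contra fi => /eqP e.
  by apply/eqP/val_inj; rewrite ffunE /= -e.
have cardE : #|F|%:R = \sum_(f in fam) #|F|%:R *+ (f == f0) :> algC.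
  rewrite (bigD1 f0) //= eqxx mulr1n big1 ?addr0 // => f /andP[_ /negPf ->].
  by rewrite mulr0n.
rewrite countE [X in _ - X]cardE -sumrB; apply: le_trans (ler_norm_sum _ _ _) _.
apply: (@le_trans _ _ (\sum_(f in fam) D%:R * sqrtC #|F|%:R)); first exact: ler_sum.
rewrite sumr_const -[leLHS]mulr_natl. apply: ler_wpM2r.
  by rewrite mulr_ge0 ?sqrtC_ge0 ?ler0n.
rewrite ler_nat.
have -> : (\prod_i M i = \prod_i \sum_(a : 'I_n | (a < M i)%N) 1)%N.
  apply: eq_bigr => i _; rewrite -(big_ord_widen _ (fun=> 1%N) (Mle i)).
  by rewrite sum1_card card_ord.
rewrite bigA_distr_big_dep -sum1_card; apply: leq_sum => f _.
by rewrite big1.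
Qed.

(** Once squared, the inequality compares integers, and so passes from [algC] to any real closed
    field. *)
Lemma class_count_bound (R : rcfType) :
  `|class_count%:R - #|F|%:R / (\prod_i M i)%:R| <= D%:R * Num.sqrt #|F|%:R :> R.
Proof.
pose P := (\prod_i M i)%N; pose x : int := (class_count * P)%:Z - #|F|%:Z.
have P0 : (0 < P)%N by apply: prodn_gt0 => i; apply: modulus_gt0.
have sqr_le : x ^+ 2 <= ((P * D) ^ 2 * #|F|)%:Z.
  rewrite -(ler_int algC) rmorphXn /= /x rmorphB /= -!pmulrn.
  rewrite -[X in X <= _]real_normK ?rpredB ?realn //.
  have q0 : 0 <= #|F|%:R :> algC by apply: ler0n.
  have -> : ((P * D) ^ 2 * #|F|)%:R = (P%:R * (D%:R * sqrtC #|F|%:R)) ^+ 2 :> algC.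
    by rewrite mulrA exprMn sqrtCK natrM natrX natrM.
  rewrite ler_sqr ?nnegrE ?mulr_ge0 ?sqrtC_ge0 ?ler0n //.
  exact: class_count_algC.
have PR : 0 < P%:R :> R by rewrite ltr0n.
rewrite -(ler_pM2r PR) -[X in _ * X <= _](ger0_norm (ltW PR)) -normrM mulrBl divfK ?gt_eqF //.
rewrite -(@ler_sqr R) ?nnegrE ?mulr_ge0 ?sqrtr_ge0 ?ler0n ?normr_ge0 //.
rewrite real_normK ?num_real // !exprMn sqr_sqrtr ?ler0n //.
have := sqr_le; rewrite -(ler_int R) rmorphXn /= /x rmorphB /= -!pmulrn natrM.
rewrite natrM natrX natrM exprMn => /le_trans; apply.
by rewrite mulrAC [P%:R ^+ 2 * _]mulrC mulrAC.
Qed.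

End ClassCount.

(** * The main constant *)

Section DivisorSum.
Variable R : numFieldType.

Definition squarefree_nat (n : nat) : bool :=
  (0 < n)%N && all (fun p => logn p n == 1%N) (primes n).

Lemma sqr_mobius (n : nat) : ((mobius n)%:~R ^+ 2 : R) = (squarefree_nat n)%:R.
Proof.
rewrite /mobius -/(squarefree_nat n); case: ifP => _; last by rewrite expr0n.
by rewrite -rmorphXn /= sqrr_sign.
Qed.

Lemma primes_coprimeM (m n : nat) : coprime m n -> (0 < m)%N -> (0 < n)%N ->
  perm_eq (primes (m * n)) (primes m ++ primes n).
Proof.
move=> co_mn m0 n0; apply: uniq_perm => [||p]; first exact: primes_uniq.
  by rewrite cat_uniq !primes_uniq -coprime_has_primes // co_mn.
by rewrite mem_cat primesM.
Qed.

Lemma squarefree_natM (m n : nat) : coprime m n ->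
  squarefree_nat (m * n) = squarefree_nat m && squarefree_nat n.
Proof.
move=> co; rewrite /squarefree_nat muln_gt0.
have [->|m0] := posnP m; first by [].
have [->|n0] := posnP n; first by rewrite /= !andbF.
rewrite /= (perm_all _ (primes_coprimeM co m0 n0)) all_cat.
congr (_ && _); apply: eq_in_all => p; rewrite mem_primes => /and3P[pp _ pd];
  rewrite lognM //.
  by rewrite (@logn_coprime p n) ?addn0 // (coprime_dvdl pd co).
by rewrite (@logn_coprime p m) // coprime_sym (coprime_dvdr pd co).
Qed.

Lemma gcdn_coprimeM (x m n : nat) : coprime m n ->
  gcdn x (m * n) = (gcdn x m * gcdn x n)%N.
Proof.
move=> co; apply/eqP; rewrite eqn_dvd; apply/andP; split.
  rewrite muln_gcdr !muln_gcdl !dvdn_gcd dvdn_mulr ?dvdn_gcdl //=.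
  by rewrite dvdn_mull ?dvdn_gcdl // dvdn_mulr ?dvdn_gcdl // dvdn_gcdr.
have cog : coprime (gcdn x m) (gcdn x n).
  by apply: coprime_dvdl (dvdn_gcdr _ _) (coprime_dvdr (dvdn_gcdr _ _) co).
by rewrite dvdn_gcd Gauss_dvd // !dvdn_gcdl dvdn_mul ?dvdn_gcdr.
Qed.

Lemma gcdn_coprimeMM (m n e f : nat) : coprime m n -> (e %| m)%N -> (f %| n)%N ->
  forall y z, (y %| m)%N -> (z %| n)%N ->
  gcdn (y * z) (e * f) = (gcdn y e * gcdn z f)%N.
Proof.
move=> co em fn y z ym zn.
have coef : coprime e f by apply: coprime_dvdl em (coprime_dvdr fn co).
rewrite gcdn_coprimeM //; congr (_ * _)%N; rewrite gcdnC.
  rewrite Gauss_gcdl 1?gcdnC //; exact: coprime_dvdl em (coprime_dvdr zn co).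
rewrite Gauss_gcdr 1?gcdnC // coprime_sym; exact: coprime_dvdl ym (coprime_dvdr fn co).
Qed.

Definition const_term (e z : nat) : R :=
  let w := (z %/ gcdn z e)%N in
  ((mobius w)%:~R ^+ 2 * (totient z)%:R) / (totient w)%:R ^+ 2.

Definition const_sum (d e : nat) : R := \sum_(z <- divisors d) const_term e z.

Lemma const_termM (m n e f y z : nat) : (0 < m)%N -> (0 < n)%N ->
  coprime m n -> (e %| m)%N -> (f %| n)%N -> (y %| m)%N -> (z %| n)%N ->
  const_term (e * f) (y * z) = const_term e y * const_term f z.
Proof.
move=> m0 n0 co em fn ym zn; rewrite /const_term (gcdn_coprimeMM co em fn ym zn).
have cowz u v : (u %| y)%N -> (v %| z)%N -> coprime u v.
  move=> uy vz; apply: coprime_dvdl (dvdn_trans uy ym) _.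
  exact: coprime_dvdr (dvdn_trans vz zn) co.
have y0 : (0 < gcdn y e)%N by rewrite gcdn_gt0 (dvdn_gt0 m0 ym).
have z0 : (0 < gcdn z f)%N by rewrite gcdn_gt0 (dvdn_gt0 n0 zn).
have -> : ((y * z) %/ (gcdn y e * gcdn z f) = (y %/ gcdn y e) * (z %/ gcdn z f))%N.
  rewrite -{1}(divnK (dvdn_gcdl y e)) -{1}(divnK (dvdn_gcdl z f)) mulnACA mulnK //.
  by rewrite muln_gt0 y0.
have wy : (y %/ gcdn y e %| y)%N by apply: dvdn_div; apply: dvdn_gcdl.
have wz : (z %/ gcdn z f %| z)%N by apply: dvdn_div; apply: dvdn_gcdl.
rewrite !totient_coprime ?cowz // !sqr_mobius squarefree_natM ?cowz // -mulnb !natrM.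
rewrite exprMn invfM; ring.
Qed.

Lemma divisors_coprimeM (m n : nat) : (0 < m)%N -> (0 < n)%N -> coprime m n ->
  perm_eq (divisors (m * n)) [seq (y * z)%N | y <- divisors m, z <- divisors n].
Proof.
move=> m0 n0 co; apply: uniq_perm; first exact: divisors_uniq.
  apply: allpairs_uniq; rewrite ?divisors_uniq // => -[y z] [y' z'].
  move=> /allpairsP[[a b] /= [+ + [-> ->]]] /allpairsP[[a' b'] /= [+ + [-> ->]]] e.
  rewrite -!dvdn_divisors // => am bn a'm b'n.
  have cc u v : (u %| m)%N -> (v %| n)%N -> coprime u v.
    by move=> um vn; apply: coprime_dvdl um (coprime_dvdr vn co).
  have E u v : (u %| m)%N -> (v %| n)%N -> gcdn (u * v) m = u /\ gcdn (u * v) n = v.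
    move=> um vn; split; rewrite gcdnC.
      by rewrite Gauss_gcdl ?cc //; apply/gcdn_idPr.
    by rewrite Gauss_gcdr 1?coprime_sym ?cc //; apply/gcdn_idPr.
  have [e1 e2] := E a b am bn; have [e1' e2'] := E a' b' a'm b'n.
  by congr (_, _); [rewrite -[LHS]e1 -[RHS]e1' | rewrite -[LHS]e2 -[RHS]e2']; congr gcdn.
move=> x; rewrite -dvdn_divisors ?muln_gt0 ?m0 //; apply/idP/allpairsP => [xmn|].
  exists (gcdn x m, gcdn x n); rewrite -!dvdn_divisors // !dvdn_gcdr; split=> //=.
  by rewrite -gcdn_coprimeM //; apply/esym/gcdn_idPl.
by case=> -[y z] /=; rewrite -!dvdn_divisors // => -[ym zn ->]; apply: dvdn_mul.
Qed.

Lemma const_sumM (m n e f : nat) : (0 < m)%N -> (0 < n)%N -> coprime m n ->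
  (e %| m)%N -> (f %| n)%N -> const_sum (m * n) (e * f) = const_sum m e * const_sum n f.
Proof.
move=> m0 n0 co em fn.
rewrite /const_sum (perm_big _ (divisors_coprimeM m0 n0 co)) /= big_allpairs_dep.
rewrite mulr_suml big_seq [RHS]big_seq; apply: eq_bigr => y.
rewrite -dvdn_divisors // => ym; rewrite mulr_sumr big_seq [RHS]big_seq.
apply: eq_bigr => z; rewrite -dvdn_divisors // => zn.
exact: (const_termM m0 n0).
Qed.

Lemma squarefree_pfactor (p k : nat) : prime p -> squarefree_nat (p ^ k) = (k <= 1)%N.
Proof.
move=> pp; rewrite /squarefree_nat expn_gt0 prime_gt0 //=.
case: k => [|k] //; rewrite primesX // primes_prime //= pfactorK // andbT.
by case: k.
Qed.

Lemma sum_totient_pfactor (p k : nat) : prime p ->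
  (\sum_(0 <= i < k.+1) totient (p ^ i))%N = (p ^ k)%N.
Proof.
move=> pp; elim: k => [|k IH]; first by rewrite big_nat1 expn0.
rewrite big_nat_recr //= IH totient_pfactor // -{1}[(p ^ k)%N]mul1n -mulnDl expnS.
by congr (_ * _)%N; rewrite add1n prednK // prime_gt0.
Qed.

(** The terms at p^i with i <= b have w = 1 and add up to p^b. If b < a, the term at i = b + 1 has w
    = p and equals p^b / (p - 1); for larger i, w is not squarefree. *)
Lemma const_sum_pfactor (p a b : nat) : prime p -> (b <= a)%N ->
  const_sum (p ^ a) (p ^ b) = (p ^ a)%:R / (totient (p ^ (a - b)))%:R.
Proof.
move=> pp ba; have p0 := prime_gt0 pp; have p1 := prime_gt1 pp.
have perm : perm_eq (divisors (p ^ a)) [seq (p ^ i)%N | i <- iota 0 a.+1].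
  apply: uniq_perm; first exact: divisors_uniq.
    by rewrite map_inj_uniq ?iota_uniq // => i k /eqP; rewrite eqn_exp2l // => /eqP.
  move=> x; rewrite -dvdn_divisors ?expn_gt0 ?p0 //; apply/dvdn_pfactor/mapP => //.
    by move=> [i ia ->]; exists i; rewrite // mem_iota ltnS.
  by move=> [i]; rewrite mem_iota ltnS => ia ->; exists i.
have gcdE i : gcdn (p ^ i) (p ^ b) = (p ^ minn i b)%N.
  have [ib|/ltnW bi] := leqP i b; first by apply/gcdn_idPl; rewrite dvdn_exp2l.
  by apply/gcdn_idPr; rewrite dvdn_exp2l.
have termE i : const_term (p ^ b) (p ^ i) =
    (i - b <= 1)%:R * (totient (p ^ i))%:R / (totient (p ^ (i - b)))%:R ^+ 2.
  rewrite /const_term gcdE -expnB ?geq_minl // sqr_mobius squarefree_pfactor //.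
  by have -> : (i - minn i b = i - b)%N by rewrite minnE subKn // leq_subr.
rewrite /const_sum (perm_big _ perm) big_map -[iota 0 a.+1]/(index_iota 0 a.+1).
have low : \sum_(0 <= i < b.+1) const_term (p ^ b) (p ^ i) = (p ^ b)%:R.
  rewrite -[in RHS](sum_totient_pfactor b pp) natr_sum [LHS]big_nat [RHS]big_nat.
  apply: eq_bigr => i /andP[_ ib]; rewrite ltnS in ib; rewrite termE.
  by have/eqP -> : (i - b == 0)%N; rewrite ?subn_eq0 // expn0 expr1n divr1 mul1r.
have [ab|lt_ba] := leqP a b.
  have -> : a = b by apply/eqP; rewrite eqn_leq ab.
  by rewrite low subnn expn0 divr1.
rewrite (@big_cat_nat _ _ _ b.+1) ?ltnS ?(ltnW lt_ba) //=.
rewrite low (@big_ltn _ _ _ b.+1) ?ltnS // big1_seq ?addr0 => [|i]; last first.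
  move=> /andP[_]; rewrite mem_index_iota => /andP[bi _]; rewrite termE.
  by rewrite leqNgt ltn_subRL addn1 bi !mul0r.
rewrite termE subSnn expn1 (totient_prime pp) !(totient_pfactor pp) ?subn_gt0 //= mul1r.
have pn0 : (p.-1)%:R != 0 :> R by rewrite pnatr_eq0 -lt0n -ltnS prednK.
have pr0 : p%:R != 0 :> R by rewrite pnatr_eq0 -lt0n.
have pE : p%:R = (p.-1)%:R + 1 :> R by rewrite natr1 prednK.
have -> : (p ^ a)%:R = (p ^ b)%:R * p%:R * (p ^ (a - b).-1)%:R :> R.
  rewrite -!natrM -expnSr -expnD; congr (_ ^ _)%:R.
  by rewrite -subn1 addSn -addnS subn1 prednK ?subn_gt0 // subnKC // ltnW.
rewrite !natrM invfM.
have pk0 : (p ^ (a - b).-1)%:R != 0 :> R by rewrite pnatr_eq0 -lt0n expn_gt0 p0.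
rewrite pE; field.
by rewrite pk0 pn0.
Qed.

(** Both sides are multiplicative in the pair of [d] and [e]; the induction splits off the part of
    one prime. *)
Lemma const_sumE (d e : nat) : (0 < d)%N -> (e %| d)%N ->
  const_sum d e = d%:R / (totient (d %/ e))%:R.
Proof.
have [k] := ubnP d; elim: k d e => // k IH d e; rewrite ltnS => dk d0 ed.
have e0 : (0 < e)%N := dvdn_gt0 d0 ed.
have [d1|d1] := leqP d 1.
  have -> : d = 1%N by apply/eqP; rewrite eqn_leq d1.
  have -> : e = 1%N by apply/eqP; rewrite eqn_leq e0 (leq_trans (dvdn_leq d0 ed)).
  have /= := @const_sum_pfactor 2 0 0 isT isT; rewrite !expn0 => ->.
  by rewrite divnn.
pose p := pdiv d; have pp : prime p := pdiv_prime d1.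
have p0 := prime_gt0 pp; have p1 := prime_gt1 pp.
have [m pm dE] := pfactor_coprime pp d0; have [f pf eE] := pfactor_coprime pp e0.
set a := logn p d in dE; set b := logn p e in eE.
have m0 : (0 < m)%N by move: d0; rewrite dE muln_gt0 => /andP[].
have a0 : (0 < a)%N by rewrite logn_gt0 mem_primes pp d0 pdiv_dvd.
have ba : (b <= a)%N by apply: dvdn_leq_log.
have cop : coprime (p ^ a) m by apply: coprimeXl.
have fm : (f %| m)%N.
  have : (f %| m * p ^ a)%N by rewrite -dE; apply: dvdn_trans ed; rewrite eE dvdn_mulr.
  by rewrite Gauss_dvdl // coprimeXr // coprime_sym.
have md : (m < d)%N.
  rewrite dE -[X in (X < _)%N]muln1 ltn_pmul2l // -(exp1n a) ltn_exp2r //.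
have deE : (d %/ e = p ^ (a - b) * (m %/ f))%N.
  rewrite {1}dE {1}eE -{1}(subnK ba) expnD mulnC [(f * _)%N]mulnC -mulnA.
  rewrite -{1}(divnK fm) [(_ %/ f * f)%N]mulnC mulnA [(_ * (f * _))%N]mulnA.
  rewrite [X in (X %/ _)%N](_ : _ = (p ^ (a - b) * (m %/ f)) * (p ^ b * f))%N; last by ring.
  by rewrite mulnK // muln_gt0 expn_gt0 p0 (dvdn_gt0 m0 fm).
rewrite deE dE eE mulnC [(f * _)%N]mulnC const_sumM ?expn_gt0 ?p0 ?dvdn_exp2l //.
rewrite const_sum_pfactor // IH ?(leq_trans md) // totient_coprime; last first.
  by apply: coprime_dvdl (dvdn_exp2l p (leq_subr b a)) (coprime_dvdr (dvdn_div fm) cop).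
by rewrite !natrM invfM mulrACA.
Qed.

End DivisorSum.

(** * Euler products and the number of prime divisors *)

Lemma prod_primesE (n : nat) : (0 < n)%N ->
  n = (\prod_(p <- primes n) p ^ logn p n)%N.
Proof.
by move=> n0; rewrite {1}(prod_prime_decomp n0) prime_decompE big_map.
Qed.

Lemma totient_ratio (R : numFieldType) (n : nat) : (0 < n)%N ->
  (totient n)%:R / n%:R = \prod_(p <- primes n) (1 - p%:R^-1) :> R.
Proof.
move=> n0; rewrite totientE // {3}(prod_primesE n0) !natr_prod -prodf_div.
rewrite big_seq [RHS]big_seq; apply: eq_bigr => p.
rewrite mem_primes => /and3P[pp _ pn]; have p0 := prime_gt0 pp.
have l0 : (0 < logn p n)%N by rewrite logn_gt0 mem_primes pp n0 pn.
have pr0 : p%:R != 0 :> R by rewrite pnatr_eq0 -lt0n.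
have pk0 : (p ^ (logn p n).-1)%:R != 0 :> R by rewrite pnatr_eq0 -lt0n expn_gt0 p0.
rewrite -{2}(prednK l0) expnS !natrM invfM mulrACA divff // mulr1.
by rewrite -subn1 natrB // mulrBl divff // mul1r.
Qed.

(** The quotient of the Euler products of [N] and [k], in which the primes dividing [k] cancel. *)
Lemma sieve_density (R : numFieldType) (N k : nat) : (0 < N)%N -> (k %| N)%N ->
  \prod_(p <- [seq p <- primes N | ~~ (p %| k)%N]) (1 - p%:R^-1) =
  (totient N)%:R / N%:R * (k%:R / (totient k)%:R) :> R.
Proof.
move=> N0 kN; have k0 : (0 < k)%N := dvdn_gt0 N0 kN.
have kk : k%:R / (totient k)%:R = ((totient k)%:R / k%:R)^-1 :> R by rewrite invf_div.
rewrite kk !totient_ratio // big_filter [in RHS](bigID (fun p => p %| k)%N) /=.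
have -> : \prod_(p <- primes N | (p %| k)%N) (1 - p%:R^-1) =
    \prod_(p <- primes k) (1 - p%:R^-1) :> R.
  rewrite -big_filter; apply/perm_big/uniq_perm; rewrite ?filter_uniq ?primes_uniq //.
  move=> p; rewrite mem_filter !mem_primes k0 N0 /= andbCA; congr (_ && _).
  by case: (boolP (p %| k)%N) => //= pk; rewrite (dvdn_trans pk kN).
rewrite mulrAC divff ?mul1r // -totient_ratio // mulf_neq0 ?invr_eq0 //.
  by rewrite pnatr_eq0 -lt0n totient_gt0.
by rewrite pnatr_eq0 -lt0n.
Qed.

Lemma totient_le (n : nat) : (totient n <= n)%N.
Proof.
rewrite totient_count_coprime -[X in (_ <= X)%N]subn0 -[X in (_ <= X)%N]muln1.
by rewrite -sum_nat_const_nat; apply: leq_sum => i _; apply: leq_b1.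
Qed.

Section MainConst.
Variables (R : realType) (r : nat) (d_ : 'I_r -> nat) (d : nat).
Hypotheses (d_gt0 : (0 < d)%N) (dd : forall i, (d_ i %| d)%N).

Lemma main_constE : main_const R d_ d = \prod_(i < r) (totient (d %/ d_ i))%:R^-1.
Proof.
have d0 : d%:R != 0 :> R by rewrite pnatr_eq0 -lt0n.
rewrite /main_const.
rewrite (eq_bigr (fun i => d%:R * (totient (d %/ d_ i))%:R^-1)) => [|i _]; last first.
  exact: const_sumE.
by rewrite big_split /= prodr_const card_ord mulrA mul1r mulVf ?mul1r // expf_neq0.
Qed.

Lemma main_const_bounds : 1 / d%:R ^+ r <= main_const R d_ d <= 1.
Proof.
have phi0 i : (0 < totient (d %/ d_ i))%N.
  by rewrite totient_gt0 divn_gt0 ?(dvdn_gt0 d_gt0) // dvdn_leq.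
rewrite main_constE mul1r -exprVn -{1}(card_ord r) -prodr_const; apply/andP; split.
  apply: ler_prod => i _; rewrite invr_ge0 ler0n /= lef_pV2 ?posrE ?ltr0n // ler_nat.
  exact: leq_trans (totient_le _) (leq_div _ _).
apply: prodr_ile1 => i _; rewrite invr_ge0 ler0n invf_le1 ?ltr0n // ler1n.
exact: phi0.
Qed.

End MainConst.

(** A prime p >= y has p^eps >= A, where y bounds A^(1/eps), and so pays for its own factor. The
    primes below y are at most y in number and cost at most the constant A^y. *)
Lemma omega_bound (R : realType) (A : nat) (eps : R) : (0 < A)%N -> 0 < eps ->
  exists2 C : R, 0 <= C & forall n, (0 < n)%N ->
    (A ^ size (primes n))%:R <= C * powR n%:R eps.
Proof.
move=> A0 e0; pose y := Num.bound (powR A%:R eps^-1).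
have Ay : A%:R <= powR y%:R eps :> R.
  have -> : A%:R = powR (powR A%:R eps^-1) eps :> R.
    by rewrite -powRrM mulVf ?gt_eqF // powRr1 ?ler0n.
  apply: ge0_ler_powR; rewrite ?nnegrE ?powR_ge0 ?ler0n ?(ltW e0) //.
  by apply/ltW/archi_boundP/powR_ge0.
exists (A ^ y)%:R => [|n n0]; first exact: ler0n.
have A1 : 1 <= A%:R :> R by rewrite ler1n.
have key (s : seq nat) : all prime s ->
    (A ^ size s)%:R <=
    (A ^ count (fun p => p < y)%N s)%:R * powR (\prod_(p <- s) p)%:R eps :> R.
  elim: s => [|p s IH] /=; first by rewrite !expn0 big_nil powR1 mul1r.
  move=> /andP[pp /IH {}IH]; rewrite big_cons natrM powRM ?ler0n // expnS natrM.
  rewrite expnD natrM mulrACA; apply: ler_pM; rewrite ?ler0n //.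
  have p1 : 1 <= powR p%:R eps :> R.
    rewrite -[leLHS](powRr0 p%:R); apply: ler_powR (ltW e0).
    by rewrite ler1n prime_gt0.
  case: ltnP => py; rewrite ?expn1 ?expn0 ?mul1r; first by rewrite ler_peMr ?ler0n.
  apply: le_trans Ay _; apply: ge0_ler_powR; rewrite ?nnegrE ?ler0n ?ler_nat //.
  exact: ltW.
have /key/le_trans : all prime (primes n) by apply/allP => p; rewrite mem_primes => /andP[].
apply; apply: ler_pM; rewrite ?ler0n ?powR_ge0 //.
  rewrite ler_nat leq_pexp2l // -size_filter -[y in (_ <= y)%N](size_iota 0).
  apply: uniq_leq_size; first by rewrite filter_uniq ?primes_uniq.
  by move=> p; rewrite mem_filter mem_iota => /andP[].
apply: ge0_ler_powR; rewrite ?nnegrE ?ler0n ?ler_nat ?(ltW e0) //.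
rewrite {2}(prod_primesE n0) big_seq [X in (_ <= X)%N]big_seq; apply: leq_prod => p.
rewrite mem_primes => /and3P[pp _ pn]; rewrite -{1}(expn1 p) leq_exp2l ?prime_gt1 //.
by rewrite logn_gt0 mem_primes pp n0 pn.
Qed.

(** * The sieve *)

Lemma coprime_prod_primes (p : nat) (s : seq nat) : prime p -> all prime s ->
  p \notin s -> coprime p (\prod_(l <- s) l).
Proof.
move=> pp ps pns; rewrite big_seq; apply: (big_ind (coprime p)).
- exact: coprimen1.
- by move=> u v cu cv; rewrite coprimeMr cu.
move=> l ls; have pl : prime l by apply: (allP ps).
by rewrite prime_coprime // dvdn_prime2 //; apply: contraNneq pns => ->.
Qed.

Lemma prod_primes_dvdn (s : seq nat) (N : nat) : all prime s -> uniq s ->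
  (forall p, p \in s -> (p %| N)%N) -> (\prod_(p <- s) p %| N)%N.
Proof.
elim: s => [|p s IH] /=; first by rewrite big_nil dvd1n.
move=> /andP[pp ps] /andP[pns us] h; rewrite big_cons Gauss_dvd ?coprime_prod_primes //.
by rewrite h ?mem_head //= IH // => l ls; apply: h; rewrite inE ls orbT.
Qed.

(* For [M] and [b] divisible by [dv], the class of the multiples of [p * dv]
   inside the class of [b] modulo [M], seen modulo [M * p]. *)
Definition refine_class (dv p b M : nat) : nat :=
  (chinese (M %/ dv) p (b %/ dv) 0 * dv)%N.

(** Both sides force [dv] to divide [e]; after division by [dv] this is the Chinese remainder
    theorem for [M0] and [p]. *)
Lemma refine_classP (p dv M0 b e : nat) : (0 < dv)%N -> (dv %| b)%N -> coprime M0 p ->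
  (e == refine_class dv p b (dv * M0) %[mod dv * M0 * p])%N =
  (e == b %[mod dv * M0])%N && (p * dv %| e)%N.
Proof.
move=> dv0 /dvdnP[b1 ->] co; rewrite /refine_class mulKn // mulnK //.
set c := chinese M0 p b1 0.
have modE u v w : (u * dv == v * dv %[mod dv * w])%N = (u == v %[mod w])%N.
  by rewrite ![(_ * dv)%N]mulnC -!muln_modr eqn_pmul2l.
have notdv v w : ~~ (dv %| e)%N -> (e == v * dv %[mod dv * w])%N = false.
  move=> ne; apply: contraNF ne => /eqP ev.
  by rewrite /dvdn -(modn_dvdm e (dvdn_mulr w (dvdnn dv))) ev modn_dvdm ?modnMl ?dvdn_mulr.
have [/dvdnP[u ->]|ne] := boolP (dv %| e)%N; last first.
  rewrite -mulnA !notdv //.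
rewrite -mulnA !modE chinese_remainder // dvdn_pmul2r //.
have := chinese_modl co b1 0; have := chinese_modr co b1 0; rewrite -/c => -> ->.
by rewrite mod0n.
Qed.

(* An entry [(s, b, M)] of [T] stands for [s] times the indicator function of the
   residue class of [b] modulo [M]. *)
Lemma sieve_classes (R : numFieldType) (P : seq nat) (dv k b0 : nat) :
  (0 < dv)%N -> (0 < k)%N -> (dv %| b0)%N -> uniq P -> all prime P ->
  all (fun p => ~~ (p %| k)%N) P ->
  exists T : seq (int * nat * nat),
    [/\ size T = (2 ^ size P)%N,
        forall t, t \in T -> [/\ `|t.1.1| = 1, (dv %| t.1.2)%N &
          exists2 m, (m %| \prod_(p <- P) p)%N & t.2 = (dv * (k * m))%N],
        forall e, ((e == b0 %[mod dv * k])%N && all (fun p => ~~ (p * dv %| e)%N) P)%:R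
           = \sum_(t <- T) t.1.1 * (e == t.1.2 %[mod t.2])%N%:R &
        \sum_(t <- T) t.1.1%:~R / t.2%:R =
          (dv * k)%:R^-1 * \prod_(p <- P) (1 - p%:R^-1) :> R].
Proof.
move=> dv0 k0 db0; elim: P => [|p P IH] /=.
  move=> _ _ _; exists [:: (1 : int, b0, (dv * k)%N)]; split=> //.
  - by move=> t; rewrite inE => /eqP -> /=; split=> //; exists 1%N; rewrite ?muln1.
  - by move=> e; rewrite big_seq1 mul1r andbT.
  by rewrite big_seq1 big_nil mulr1 div1r.
move=> /andP[pnP uP] /andP[pp pP] /andP[pk kP].
have {IH}[T [sT TP Te Ts]] := IH uP pP kP.
pose beta (t : int * nat * nat) := refine_class dv p t.1.2 t.2.
have betaP t e : t \in T ->
    (e == beta t %[mod t.2 * p])%N = (e == t.1.2 %[mod t.2])%N && (p * dv %| e)%N.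
  move=> tT; have [_ dt [m mP eM]] := TP t tT; rewrite /beta eM refine_classP //.
  rewrite coprime_sym coprimeMr prime_coprime // pk /=.
  exact: coprime_dvdr mP (coprime_prod_primes pp pP pnP).
(* Inclusion and exclusion, one prime at a time: from each class subtract its subclass of multiples
   of [p * dv]. This doubles the list and multiplies the density by 1 - 1/p. *)
exists (T ++ [seq (- t.1.1, beta t, (t.2 * p)%N) | t <- T]); split.
- by rewrite size_cat size_map sT addnn -mul2n expnS.
- move=> t; rewrite mem_cat big_cons => /orP[tT|/mapP[u uT ->]] /=.
    have [st dt [m mP eM]] := TP t tT; split=> //; exists m => //.
    by rewrite dvdn_mull.
  have [su du [m mP ->]] := TP u uT; rewrite normrN; split=> //.
    by rewrite /beta dvdn_mull.
  by exists (m * p)%N; rewrite ?mulnA // mulnC dvdn_mul.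
- move=> e; rewrite big_cat big_map /= andbCA -big_split /=.
  rewrite (eq_big_seq (fun t => t.1.1 * (e == t.1.2 %[mod t.2])%N%:R *
     (~~ (p * dv %| e)%N)%:R)) => [|t tT]; last first.
    by rewrite betaP //; case: (e == _ %[mod _])%N; case: (_ %| _)%N;
      rewrite /= ?(mulr1, mulr0, addr0, mulNr, subrr).
  by rewrite -mulr_suml -Te -mulnb natrM mulrC.
rewrite big_cat big_map big_cons /= mulrCA -Ts mulrBl mul1r mulr_sumr; congr (_ + _).
rewrite -sumrN; apply: eq_bigr => t _.
by rewrite rmorphN /= mulNr natrM invfM mulrA mulrC.
Qed.

Definition sieve_primes (n dv k : nat) : seq nat :=
  [seq p <- primes (n %/ dv) | ~~ (p %| k)%N].

(** A prime p dividing gcd(n, e)/dv gives p dv | e. It cannot divide [k], since otherwise p dv would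
    divide gcd(e, dv k) = dv; so only primes outside [k] need to be sieved. *)
Lemma gcdn_sieve (n dv k e : nat) : (0 < n)%N -> (dv * k %| n)%N ->
  gcdn e (dv * k) = dv ->
  (gcdn n e == dv) = all (fun p => ~~ (p * dv %| e)%N) (sieve_primes n dv k).
Proof.
move=> n0 dkn ge; have dvn : (dv %| n)%N := dvdn_trans (dvdn_mulr k (dvdnn dv)) dkn.
have dv0 : (0 < dv)%N := dvdn_gt0 n0 dvn.
have dve : (dv %| e)%N by rewrite -ge dvdn_gcdl.
have N0 : (0 < n %/ dv)%N by rewrite divn_gt0 // dvdn_leq.
have pN p : (p %| n %/ dv)%N = (p * dv %| n)%N by rewrite dvdn_divRL.
apply/eqP/allP => [gn p|h].
  rewrite mem_filter mem_primes N0 => /and3P[_ pp /= pdv]; apply/negP => pe.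
  have : (p * dv %| dv)%N by rewrite -[X in (_ %| X)%N]gn dvdn_gcd -pN pdv pe.
  by rewrite -[X in (_ %| X)%N]mul1n dvdn_pmul2r // dvdn1 => /eqP p1; rewrite p1 in pp.
have dg : (dv %| gcdn n e)%N by rewrite dvdn_gcd dvn.
have g0 : (0 < gcdn n e %/ dv)%N by rewrite divn_gt0 // dvdn_leq // gcdn_gt0 n0.
have [g1|] := leqP (gcdn n e %/ dv) 1.
  by rewrite -(divnK dg) (_ : (_ %/ _ = 1)%N) ?mul1n //; apply/eqP; rewrite eqn_leq g1.
move=> g1; pose p := pdiv (gcdn n e %/ dv).
have pp : prime p := pdiv_prime g1.
have : (p * dv %| gcdn n e)%N by rewrite -dvdn_divRL // pdiv_dvd.
rewrite dvdn_gcd => /andP[pn pe].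
have [pk|pk] := boolP (p %| k)%N.
  have : (p * dv %| dv)%N by rewrite -[X in (_ %| X)%N]ge dvdn_gcd pe mulnC dvdn_pmul2l.
  by rewrite -[X in (_ %| X)%N]mul1n dvdn_pmul2r // dvdn1 => /eqP p1; rewrite p1 in pp.
have := h p; rewrite mem_filter pk mem_primes pp N0 pN pn pe => /(_ isT).
by [].
Qed.

Definition residue (j : int) (d : nat) : nat := `|(j %% d)%Z|%N.

Lemma residueP (j : int) (d e : nat) : (0 < d)%N ->
  (e%:Z == j %[mod d])%Z = (e == residue j d %[mod d])%N.
Proof.
move=> d0; have E : (residue j d)%:Z = (j %% d)%Z.
  by rewrite /residue gez0_abs // modz_ge0 // gt_eqF.
by rewrite -[(j %% d)%Z]modz_mod -E !modz_nat eqz_nat.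
Qed.

Lemma gcdn_residue (j : int) (d dv : nat) : (0 < d)%N -> gcdz j d = dv ->
  gcdn (residue j d) d = dv.
Proof.
move=> d0 g; have E : (residue j d)%:Z = (j %% d)%Z.
  by rewrite /residue gez0_abs // modz_ge0 // gt_eqF.
apply/eqP; rewrite -eqz_nat -g -gcdz_modl -E; apply/eqP.
by rewrite /gcdz !absz_nat.
Qed.

(** The order of x is n / gcd(n, log x), so the condition on it reads gcd(n, log x) = dv. The class
    modulo [d] already ensures gcd(log x, d) = dv, which makes [gcdn_sieve] applicable. *)
Lemma order_dlog_cond (F : finFieldType) (omega x : {unit F}) (d dv : nat) (j : int) :
  primitive_root omega -> (d %| #|F|.-1)%N -> (dv %| d)%N -> gcdz j d = dv ->
  (#[x]%g == #|F|.-1 %/ dv)%N && ((dlog omega x)%:Z == j %[mod d])%Z =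
  (dlog omega x == residue j d %[mod dv * (d %/ dv)])%N &&
  all (fun p => ~~ (p * dv %| dlog omega x)%N) (sieve_primes #|F|.-1 dv (d %/ dv)).
Proof.
move=> gen dn dvd g; have n0 := card_pred_gt0 F.
have d0 : (0 < d)%N := dvdn_gt0 n0 dn; have dv0 : (0 < dv)%N := dvdn_gt0 d0 dvd.
have dE : (dv * (d %/ dv) = d)%N by rewrite mulnC divnK.
rewrite residueP // dE andbC; have [/eqP ej|] //= := boolP (_ == _ %[mod d])%N.
have ge : gcdn (dlog omega x) d = dv.
  by rewrite -(gcdn_residue d0 g) -gcdn_modl ej gcdn_modl.
rewrite -gcdn_sieve ?dE // [in LHS](dlogE gen x) orderXgcd (order_primitive_root gen).
have dvn := dvdn_trans dvd dn.
apply/eqP/eqP => [e|->] //; have gn := dvdn_gcdl #|F|.-1 (dlog omega x).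
have q0 : (0 < #|F|.-1 %/ dv)%N by rewrite divn_gt0 // dvdn_leq.
by apply/eqP; rewrite -(eqn_pmul2l q0) [X in _ == X](divnK dvn) -e divnK.
Qed.

Lemma natr_forall (R : comPzSemiRingType) (I : finType) (b : pred I) :
  [forall i, b i]%:R = \prod_i (b i)%:R :> R.
Proof.
case: forallP => [h|/forallP].
  by rewrite big1 // => i _; rewrite h.
by rewrite negb_forall => /existsP[i /negPf bi]; rewrite (bigD1 i) //= bi mul0r.
Qed.

Lemma natr_card (R : pzSemiRingType) (T : finType) (b : pred T) :
  #|[pred x | b x]|%:R = \sum_x (b x)%:R :> R.
Proof.
by rewrite -sum1_card natr_sum big_mkcond; apply: eq_bigr => x _; rewrite inE; case: (b x).
Qed.

(** * The count before the error term is simplified *)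

Section Counting.
Variables (R : realType) (F : finFieldType) (omega : {unit F}) (r d : nat).
Variables (d_ : 'I_r -> nat) (j : 'I_r -> int) (Q : 'I_r -> {poly F}).
Local Notation n := #|F|.-1.
Hypotheses (gen : primitive_root omega) (dn : (d %| n)%N).
Hypotheses (dd : forall i, (d_ i %| d)%N) (jd : forall i, gcdz (j i) d = d_ i).
Hypothesis sQ : forall i, (1 < size (Q i))%N.
Hypothesis sfQ : forall i, squarefree_poly (Q i).
Hypothesis coQ : forall i k, i != k -> coprimep (Q i) (Q k).

Let k i := (d %/ d_ i)%N.
Let P i := sieve_primes n (d_ i) (k i).
Let D := (\sum_i (size (Q i)).-1)%N.

Lemma count_density :
  `|(xi_count omega d_ d j Q)%:R
    - (\prod_i ((d_ i * k i)%:R^-1 * \prod_(p <- P i) (1 - p%:R^-1))) * #|F|%:R|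
  <= (\prod_i 2 ^ size (P i))%:R * (D%:R * Num.sqrt #|F|%:R) :> R.
Proof.
have n0 := card_pred_gt0 F; have d0 : (0 < d)%N := dvdn_gt0 n0 dn.
have di0 i : (0 < d_ i)%N := dvdn_gt0 d0 (dd i).
have kE i : (d_ i * k i = d)%N by rewrite mulnC divnK.
have k0 i : (0 < k i)%N by rewrite divn_gt0 // dvdn_leq.
have PP i p : p \in P i -> prime p /\ (p %| n %/ d_ i)%N.
  by rewrite mem_filter mem_primes => /and4P[].
have allP' i : all prime (P i) by apply/allP => p /PP[].
have uP i : uniq (P i) by rewrite filter_uniq ?primes_uniq.
have Pk i : all (fun p => ~~ (p %| k i)%N) (P i).
  by apply/allP => p; rewrite mem_filter => /andP[].
have db i : (d_ i %| residue (j i) d)%N.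
  by rewrite -{1}(gcdn_residue d0 (jd i)) dvdn_gcdl.
have [T TP] := fin_all_exists (fun i =>
  sieve_classes R (di0 i) (k0 i) (db i) (uP i) (allP' i) (Pk i)).
(* A modulus is d_i k_i m with m composed of sieving primes; [k i] and m are coprime and both divide
   n / d_i. *)
have Mn i t : t \in T i -> (t.2 %| n)%N.
  case: (TP i) => _ h _ _ /h [_ _ [m mP ->]].
  have dn' := dvdn_trans (dd i) dn.
  rewrite mulnC -dvdn_divRL //; apply: dvdn_trans (dvdn_mul (dvdnn (k i)) mP) _.
  rewrite Gauss_dvd; last first.
    rewrite big_seq; apply: (big_ind (coprime (k i))) => [|u v cu cv|p pP].
    - exact: coprimen1.
    - by rewrite coprimeMr cu.
    have [pp _] := PP i p pP.
    by rewrite coprime_sym prime_coprime // (allP (Pk i)).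
  rewrite dvdn_divRL // mulnC kE dn /=.
  by apply: prod_primes_dvdn => // p /PP[].
(* The lists [T i] differ in length. Indexing all of them by ['I_L] allows the product of sums to be
   expanded over functions. *)
pose L := (\sum_i size (T i))%N.
have TL i : (size (T i) <= L)%N by rewrite /L (bigD1 i) //= leq_addr.
pose tn i (t : nat) := nth (0, 0%N, 1%N) (T i) t.
have sum_tn (V : nmodType) i (G : int * nat * nat -> V) :
    \sum_(t <- T i) G t = \sum_(t : 'I_L | (t < size (T i))%N) G (tn i t).
  rewrite (big_nth (0, 0%N, 1%N)) big_mkord.
  by rewrite (big_ord_widen _ (fun t => G (tn i t)) (TL i)).
pose fam := family (fun i (t : 'I_L) => (t < size (T i))%N).
pose sg (f : {ffun 'I_r -> 'I_L}) : R := \prod_i (tn i (f i)).1.1%:~R.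
pose M (f : {ffun 'I_r -> 'I_L}) i := (tn i (f i)).2.
pose b (f : {ffun 'I_r -> 'I_L}) i := (tn i (f i)).1.2.
have fam_in f i : f \in fam -> tn i (f i) \in T i.
  by move=> /familyP/(_ i) fi; apply: mem_nth; apply: fi.
have condE i x : [&& x != 0, #[funit x]%g == (n %/ d_ i)%N
      & ((dlog omega (funit x))%:Z == j i %[mod d])%Z]%:R =
    \sum_(t : 'I_L | (t < size (T i))%N)
      (tn i t).1.1%:~R *
      ((x != 0) && (dlog omega (funit x) == (tn i t).1.2 %[mod (tn i t).2])%N)%:R :> R.
  rewrite -(sum_tn _ i (fun t => t.1.1%:~R *
      ((x != 0) && (dlog omega (funit x) == t.1.2 %[mod t.2])%N)%:R)).
  have [_|x0] /= := eqVneq x 0; first by rewrite big1 // => t _; rewrite mulr0.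
  rewrite (order_dlog_cond _ gen dn (dd i) (jd i)).
  have [_ _ Te _] := TP i.
  have := congr1 (fun m : int => m%:~R : R) (Te (dlog omega (funit x))).
  rewrite /= rmorph_nat => ->; rewrite rmorph_sum; apply: eq_bigr => t _.
  by rewrite rmorphM /= rmorph_nat.
have countE : (xi_count omega d_ d j Q)%:R =
    \sum_(f in fam) sg f * (class_count omega Q (M f) (b f))%:R.
  rewrite /xi_count cardsE natr_card.
  under eq_bigr do rewrite natr_forall.
  under [RHS]eq_bigr do rewrite /class_count natr_card mulr_sumr.
  rewrite exchange_big /=; apply: eq_bigr => x _.
  under eq_bigr do rewrite condE.
  rewrite bigA_distr_big_dep; apply: eq_bigr => f _.
  by rewrite natr_forall /sg -big_split.
have mainE : \prod_i ((d_ i * k i)%:R^-1 * \prod_(p <- P i) (1 - p%:R^-1)) =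
    \sum_(f in fam) sg f / (\prod_i M f i)%:R :> R.
  under eq_bigr => i _.
    have [_ _ _ <-] := TP i.
    rewrite (sum_tn _ i (fun t => t.1.1%:~R / t.2%:R)); over.
  rewrite bigA_distr_big_dep; apply: eq_bigr => f _.
  by rewrite /sg natr_prod -prodf_div.
rewrite countE mainE mulr_suml -sumrB; apply: le_trans (ler_norm_sum _ _ _) _.
apply: (@le_trans _ _ (\sum_(f in fam) D%:R * Num.sqrt #|F|%:R)).
  apply: ler_sum => f ff; rewrite -mulrA -mulrBr normrM.
  have -> : `|sg f| = 1.
    rewrite /sg normr_prod big1 // => i _; have [_ h _ _] := TP i.
    by have [s1 _ _] := h _ (fam_in f i ff); rewrite -intr_norm s1.
  rewrite mul1r [_^-1 * _]mulrC; apply: class_count_bound => // i.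
  exact/Mn/fam_in.
rewrite sumr_const -[leLHS]mulr_natl; apply: ler_wpM2r.
  by rewrite mulr_ge0 ?sqrtr_ge0 ?ler0n.
rewrite ler_nat.
have -> : (\prod_i 2 ^ size (P i) = \prod_i \sum_(t : 'I_L | (t < size (T i))%N) 1)%N.
  apply: eq_bigr => i _; rewrite -(big_ord_widen _ (fun=> 1%N) (TL i)).
  by rewrite sum1_card card_ord; have [-> _ _ _] := TP i.
rewrite bigA_distr_big_dep -sum1_card; apply: leq_sum => f _.
by rewrite big1.
Qed.

End Counting.

Theorem theorem3p3 (R : realType) (r : nat) (d_ : 'I_r -> nat) (d : nat)
    (d_gt0 : (0 < d)%N) (di_gt0 : forall i, (0 < d_ i)%N)
    (lcm_dvd : (\big[lcmn/1%N]_(i < r) d_ i %| d)%N) :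
  1 / d%:R ^+ r <= main_const R d_ d <= 1 /\
  forall eps : R, 0 < eps ->
  exists C : R,
  forall j : 'I_r -> int, (forall i, gcdz (j i) d = d_ i) ->
  forall (q : nat) (F : finFieldType), #|F| = q -> (q = 1 %[mod d])%N ->
  forall omega : {unit F}, primitive_root omega ->
  forall Q : 'I_r -> {poly F},
    (forall i, (1 < size (Q i))%N) ->
    (forall i, squarefree_poly (Q i)) ->
    (forall i k, i != k -> coprimep (Q i) (Q k)) ->
  `| (xi_count omega d_ d j Q)%:R
     - main_const R d_ d *
       ((\prod_(i < r) (totient (q.-1 %/ d_ i))%:R) / (q.-1)%:R ^+ r) * q%:R |
  <= C * (\sum_(i < r) (size (Q i)).-1)%:R * powR q%:R (1 / 2 + eps).
Proof.
have dd i : (d_ i %| d)%N by apply: dvdn_trans (biglcmn_sup i _ _) lcm_dvd.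
split; first exact: main_const_bounds.
move=> eps eps0.
(* Every sieving prime divides n, so each of the r lists of classes has at most 2^omega(n) entries,
   and the choices number at most (2^r)^omega(n). *)
have [C C0 CP] := @omega_bound R (2 ^ r) eps (expn_gt0 2 r) eps0.
exists C => j jd q F <- qd omega gen Q sQ sfQ coQ.
have n0 := card_pred_gt0 F; set n := #|F|.-1 in n0 *.
have dn : (d %| n)%N.
  by have := eqn_mod_dvd d (ltnW (finNzRing_gt1 F)); rewrite qd eqxx subn1 => <-.
have := count_density R gen dn dd jd sQ sfQ coQ; rewrite -/n.
set D := (\sum_i _)%N.
(* With N = n / d_i and k = d / d_i, the factor at i is (1/(d_i k)) (phi(N)/N) (k/phi(k)), which
   equals phi(N) / (n phi(k)). *)
have -> : \prod_i ((d_ i * (d %/ d_ i))%:R^-1 *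
      \prod_(p <- sieve_primes n (d_ i) (d %/ d_ i)) (1 - p%:R^-1)) =
    main_const R d_ d * ((\prod_(i < r) (totient (n %/ d_ i))%:R) / n%:R ^+ r).
  rewrite main_constE // -[X in _ ^+ X](card_ord r) -prodr_const -prodf_div -big_split /=.
  apply: eq_bigr => i _; have dn' := dvdn_trans (dd i) dn.
  have k0 : (0 < d %/ d_ i)%N by rewrite divn_gt0 // dvdn_leq.
  have N0 : (0 < n %/ d_ i)%N by rewrite divn_gt0 // dvdn_leq.
  rewrite sieve_density //; last by rewrite dvdn_divRL // divnK.
  have nE : n%:R = (n %/ d_ i)%:R * (d_ i)%:R :> R by rewrite -natrM divnK.
  rewrite nE natrM.
  have kr : (d %/ d_ i)%:R != 0 :> R by rewrite pnatr_eq0 -lt0n.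
  have Nr : (n %/ d_ i)%:R != 0 :> R by rewrite pnatr_eq0 -lt0n.
  have dr : (d_ i)%:R != 0 :> R by rewrite pnatr_eq0 -lt0n.
  have pr : (totient (d %/ d_ i))%:R != 0 :> R by rewrite pnatr_eq0 -lt0n totient_gt0.
  by field; rewrite kr Nr dr pr.
move/le_trans; apply.
rewrite mulrCA [C * _]mulrC -[X in _ <= X]mulrA; apply: ler_wpM2l; first exact: ler0n.
rewrite powRD; last by apply/implyP => _; rewrite pnatr_eq0 -lt0n (ltnW (finNzRing_gt1 F)).
rewrite div1r powR12_sqrt ?ler0n // mulrC mulrCA; apply: ler_wpM2l; first exact: sqrtr_ge0.
apply: (@le_trans _ _ (C * powR n%:R eps)).
  apply: le_trans (CP n n0); rewrite ler_nat -expnM.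
  rewrite -expn_sum leq_exp2l // -[X in (_ <= X * _)%N](card_ord r) -sum_nat_const.
  apply: leq_sum => i _; have dn' := dvdn_trans (dd i) dn.
  apply: uniq_leq_size => [|p]; first by rewrite filter_uniq ?primes_uniq.
  rewrite mem_filter !mem_primes n0 => /and4P[_ -> _ pN] /=.
  exact: dvdn_trans pN (dvdn_div dn').
apply: ler_wpM2l => //; apply: ge0_ler_powR; rewrite ?nnegrE ?ler0n ?(ltW eps0) //.
by rewrite ler_nat leq_pred.
Qed.
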